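(* Let $(n_k)_{k\ge1}$ be a sequence of positive integers satisfying the Hadamard gap condition $n_{k+1}/n_k\ge q>1$ for all $k\ge1$, and let $\sigma:\mathbb{N}\to\mathbb{N}$ be any permutation. Then $$\limsup_{N\to\infty}\frac{\sum_{k=1}^N\cos(2\pi n_{\sigma(k)}x)}{\sqrt{2N\log\log N}}=\frac1{\sqrt2}$$ for almost every $x\in(0,1)$. *)

(* Defs.v *)
From Stdlib Require Import Reals.
Open Scope R_scope.

Fixpoint psum (f : nat -> R) (N : nat) : R :=
  match N with
  | O => 0
  | S m => psum f m + f m
  end.

Definition lebesgue_null (E : R -> Prop) : Prop :=
  forall eps : R, 0 < eps ->
    exists a b : nat -> R,
      (forall i, a i <= b i) /\
      (forall x, E x -> exists i, a i < x < b i) /\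
      (forall m, sum_f_R0 (fun i => b i - a i) m <= eps).

Definition ae_in_01 (P : R -> Prop) : Prop :=
  lebesgue_null (fun x => 0 < x < 1 /\ ~ P x).

Definition limsup_eq (u : nat -> R) (L : R) : Prop :=
  forall eps : R, 0 < eps ->
    (exists N0 : nat, forall N, (N0 <= N)%nat -> u N <= L + eps) /\
    (forall N0 : nat, exists N, (N0 <= N)%nat /\ L - eps <= u N).

(* Hadamard gap condition with ratio q > 1 for a positive integer sequence
   indexed from 0 (n 0 = n_1 in the paper). *)
Definition hadamard_gap (n : nat -> nat) (q : R) : Prop :=
  1 < q /\ (forall k, (0 < n k)%nat) /\
  (forall k, INR (n (S k)) / INR (n k) >= q).

Definition is_permutation (s : nat -> nat) : Prop :=
  (forall i j, s i = s j -> i = j) /\ (forall j, exists i, s i = j).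

(* Main.v *)
(* Cut the frequencies into long blocks separated by short gaps and let U_j be the j-th block sum.
   The product of 1 + U_j + U_j^2/2 over j can be averaged exactly: after a gap, all nonconstant
   frequencies of a factor exceed the degree of the product of the earlier ones.  This gives E exp(sum_m c_m cos(2 pi n_m x)) = exp(V/4 + O(err)),
   V = sum_m c_m^2, uniformly in the coefficients c.  Permuting the terms only permutes the
   coefficients, so the estimate applies verbatim to permuted sums.
   The upper bound follows from exponential Markov inequalities, Borel-Cantelli and a three-scale
   chaining.  For the lower bound, let W_k be the exponentially tilted densities of the sums over
   [T^k, T^(k+1)): they are almost uncorrelated although the frequencies interleave, because their
   products are again exponentials of lacunary sums.  The average of W_k over K <= k < 2K, truncated
   at a power of K, therefore concentrates near 1, whereas under each W_k a sum well below its tilted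
   mean is improbable; so the set where all these sums are small has measure tending to 0. *)
Require Import Defs.
From Stdlib Require Import Reals ZArith Arith Arith.Cantor Psatz.
From Stdlib Require Import Classical ClassicalEpsilon.
From Coquelicot Require Import Coquelicot.
Open Scope R_scope.

Lemma psum_S f N : psum f (S N) = psum f N + f N.
Proof. reflexivity. Qed.

Lemma psum_ext f g N : (forall i, (i < N)%nat -> f i = g i) -> psum f N = psum g N.
Proof.
  induction N as [|N IH]; intros H; simpl; [reflexivity|].
  rewrite IH, H; auto; intros; apply H; lia.
Qed.

Lemma psum_plus f g N : psum (fun i => f i + g i) N = psum f N + psum g N.
Proof. induction N; simpl; [lra|rewrite IHN; lra]. Qed.

Lemma psum_scal c f N : psum (fun i => c * f i) N = c * psum f N.
Proof. induction N; simpl; [lra|rewrite IHN; lra]. Qed.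

Lemma psum_const c N : psum (fun _ => c) N = INR N * c.
Proof. induction N; [simpl; lra|]. rewrite S_INR; simpl; rewrite IHN; lra. Qed.

Lemma psum_le f g N : (forall i, (i < N)%nat -> f i <= g i) -> psum f N <= psum g N.
Proof.
  induction N as [|N IH]; intros H; simpl; [lra|].
  pose proof (H N ltac:(lia)). pose proof (IH (fun i h => H i ltac:(lia))). lra.
Qed.

Lemma psum_ge0 f N : (forall i, (i < N)%nat -> 0 <= f i) -> 0 <= psum f N.
Proof.
  intros H. rewrite <- (psum_le (fun _ => 0) f N H). rewrite psum_const; lra.
Qed.

Lemma psum_split f a b : psum f (a + b) = psum f a + psum (fun i => f (a + i)%nat) b.
Proof.
  induction b as [|b IH]; simpl.
  - replace (a + 0)%nat with a by lia. lra.
  - replace (a + S b)%nat with (S (a + b)) by lia. simpl. rewrite IH. lra.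
Qed.

Lemma psum_mono f M N : (forall i, 0 <= f i) -> (M <= N)%nat -> psum f M <= psum f N.
Proof.
  intros H HMN. replace N with (M + (N - M))%nat by lia. rewrite psum_split.
  pose proof (psum_ge0 (fun i => f (M + i)%nat) (N - M) (fun i _ => H _)). lra.
Qed.

Lemma psum_term f N k : (forall i, (i < N)%nat -> 0 <= f i) -> (k < N)%nat -> f k <= psum f N.
Proof.
  induction N as [|N IH]; intros H Hk; [lia|]. simpl.
  pose proof (psum_ge0 f N (fun i h => H i ltac:(lia))).
  pose proof (H N ltac:(lia)).
  destruct (Nat.eq_dec k N) as [->|Hn]; [lra|].
  pose proof (IH (fun i h => H i ltac:(lia)) ltac:(lia)). lra.
Qed.

Lemma psum_swap (f : nat -> nat -> R) M N :
  psum (fun i => psum (f i) N) M = psum (fun j => psum (fun i => f i j) M) N.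
Proof.
  induction M as [|M IH]; simpl.
  - rewrite psum_const; lra.
  - rewrite IH, psum_plus. reflexivity.
Qed.

Lemma psum_sum_f_R0 f m : sum_f_R0 f m = psum f (S m).
Proof. induction m; simpl in *; [lra|rewrite IHm; lra]. Qed.

Definition delta_nat (i j : nat) : R := if Nat.eq_dec i j then 1 else 0.

Lemma psum_delta f j N :
  psum (fun i => delta_nat i j * f i) N = if lt_dec j N then f j else 0.
Proof.
  unfold delta_nat. induction N as [|N IH]; simpl; [reflexivity|]. rewrite IH.
  destruct (Nat.eq_dec N j), (lt_dec j N), (lt_dec j (S N)); subst; try lia; lra.
Qed.

(** Push-forward of the coefficients [a] along [s]: it rewrites a sum in permuted order as a
    lacunary sum in natural order. Summing deltas avoids an inverse of [s]. *)
Definition push (s : nat -> nat) (a : nat -> R) (N m : nat) : R :=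
  psum (fun i => delta_nat m (s i) * a i) N.

Lemma push_spec s a N M g :
  (forall i, (i < N)%nat -> (s i < M)%nat) ->
  psum (fun m => push s a N m * g m) M = psum (fun i => a i * g (s i)) N.
Proof.
  intros H. unfold push.
  rewrite (psum_ext _ (fun m => psum (fun i => delta_nat m (s i) * (a i * g m)) N)).
  2:{ intros m _. rewrite Rmult_comm, <- psum_scal. apply psum_ext; intros; ring. }
  rewrite psum_swap. apply psum_ext. intros i Hi. rewrite psum_delta.
  destruct (lt_dec (s i) M) as [_|h]; [reflexivity|]. exfalso; apply h, H, Hi.
Qed.

Lemma push_out s a N m : (forall i, (i < N)%nat -> s i <> m) -> push s a N m = 0.
Proof.
  intros H. unfold push. rewrite (psum_ext _ (fun _ => 0)).
  - rewrite psum_const; lra.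
  - intros i Hi. unfold delta_nat. destruct (Nat.eq_dec m (s i)) as [e|e]; [|lra].
    exfalso; apply (H i Hi); auto.
Qed.

Lemma push_in s a N i :
  (forall i j, s i = s j -> i = j) -> (i < N)%nat -> push s a N (s i) = a i.
Proof.
  intros Hs Hi. unfold push.
  rewrite (psum_ext _ (fun j => delta_nat j i * a j)).
  - rewrite psum_delta. destruct (lt_dec i N); [reflexivity|lia].
  - intros j _. unfold delta_nat.
    destruct (Nat.eq_dec (s i) (s j)) as [e|e], (Nat.eq_dec j i) as [e'|e']; auto.
    + apply Hs in e. congruence.
    + congruence.
Qed.

Lemma push_cases s a N m :
  (forall i j, s i = s j -> i = j) ->
  push s a N m = 0 \/ exists i, (i < N)%nat /\ s i = m /\ push s a N m = a i.
Proof.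
  intros Hs. destruct (classic (exists i, (i < N)%nat /\ s i = m)) as [[i [Hi <-]]|Hn].
  - right. exists i. repeat split; auto. apply push_in; auto.
  - left. apply push_out. intros i Hi e. apply Hn. eauto.
Qed.

Lemma nat_bound (s : nat -> nat) N : exists M, forall i, (i < N)%nat -> (s i < M)%nat.
Proof.
  induction N as [|N [M HM]]; [exists 0%nat; lia|].
  exists (S (Nat.max M (s N))). intros i Hi.
  destruct (Nat.eq_dec i N) as [->|Hn]; [lia|]. pose proof (HM i ltac:(lia)); lia.
Qed.

Lemma push_sq s a N M :
  (forall i j, s i = s j -> i = j) -> (forall i, (i < N)%nat -> (s i < M)%nat) ->
  psum (fun m => Rsqr (push s a N m)) M = psum (fun i => Rsqr (a i)) N.
Proof.
  intros Hs HM. unfold Rsqr at 1. rewrite (push_spec s a N M (push s a N) HM).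
  apply psum_ext. intros i Hi. rewrite push_in; auto.
Qed.

(** * The mean over the unit interval *)

(** The Riemann integral suffices as expectation: every event is majorised by a continuous function
    before a mean is taken. *)
Definition E (f : R -> R) : R := RInt f 0 1.

Lemma ex_RInt_cont f a b : continuity f -> ex_RInt f a b.
Proof.
  intros Hf. apply (@ex_RInt_continuous R_CompleteNormedModule). intros z _.
  apply continuity_pt_filterlim, Hf.
Qed.

Lemma RInt_const_R c a b : RInt (fun _ : R => c) a b = (b - a) * c.
Proof. exact (RInt_const a b c). Qed.

Lemma E_plus f g : continuity f -> continuity g -> E (fun x => f x + g x) = E f + E g.
Proof. intros; apply (RInt_plus f g); apply ex_RInt_cont; auto. Qed.

Lemma E_scal c f : continuity f -> E (fun x => c * f x) = c * E f.
Proof. intros; apply (RInt_scal f); apply ex_RInt_cont; auto. Qed.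

Lemma E_ext f g : (forall x, f x = g x) -> E f = E g.
Proof. intros H; apply RInt_ext; auto. Qed.

Lemma E_const c : E (fun _ => c) = c.
Proof. unfold E; rewrite RInt_const_R; ring. Qed.

Lemma E_le f g : continuity f -> continuity g -> (forall x, f x <= g x) -> E f <= E g.
Proof. intros; apply RInt_le; try lra; auto using ex_RInt_cont. Qed.

Lemma cont_const c : continuity (fun _ : R => c).
Proof. apply continuity_const; intros ? ?; auto. Qed.

Lemma cont_plus f g : continuity f -> continuity g -> continuity (fun x => f x + g x).
Proof. exact (continuity_plus f g). Qed.

Lemma cont_minus f g : continuity f -> continuity g -> continuity (fun x => f x - g x).
Proof. exact (continuity_minus f g). Qed.

Lemma cont_mult f g : continuity f -> continuity g -> continuity (fun x => f x * g x).
Proof. exact (continuity_mult f g). Qed.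

Lemma cont_exp f : continuity f -> continuity (fun x => exp (f x)).
Proof.
  intros H. apply (continuity_comp f exp); auto. apply derivable_continuous, derivable_exp.
Qed.

Lemma cont_psum (f : nat -> R -> R) N :
  (forall i, (i < N)%nat -> continuity (f i)) -> continuity (fun x => psum (fun i => f i x) N).
Proof.
  induction N as [|N IH]; intros H; simpl; [apply cont_const|].
  apply cont_plus; [apply IH; intros; apply H; lia|apply H; lia].
Qed.

Lemma cont_ext (f g : R -> R) : (forall x, f x = g x) -> continuity f -> continuity g.
Proof. intros H Hf x. apply continuity_pt_ext with f; auto. Qed.

Lemma cont_min f g : continuity f -> continuity g -> continuity (fun x => Rmin (f x) (g x)).
Proof.
  intros Hf Hg. apply cont_ext with (fun x => /2 * (f x + g x - Rabs (f x - g x))).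
  - intros x. unfold Rmin, Rabs. destruct (Rle_dec _ _), (Rcase_abs _); lra.
  - apply cont_mult; [apply cont_const|]. apply cont_minus; [apply cont_plus; auto|].
    apply (continuity_comp (fun x => f x - g x) Rabs); [apply cont_minus; auto|].
    exact Rcontinuity_abs.
Qed.

Lemma cont_cos c : continuity (fun x => cos (c * x)).
Proof.
  apply (continuity_comp (fun x => c * x) cos).
  - apply cont_mult; [apply cont_const|]. apply derivable_continuous, derivable_id.
  - exact continuity_cos.
Qed.

Lemma E_psum (f : nat -> R -> R) N :
  (forall i, (i < N)%nat -> continuity (f i)) ->
  E (fun x => psum (fun i => f i x) N) = psum (fun i => E (f i)) N.
Proof.
  induction N as [|N IH]; intros H; simpl; [apply E_const|].
  rewrite E_plus; [rewrite IH; auto| apply cont_psum; auto|apply H; lia].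
Qed.

Ltac cont := repeat first [assumption | apply cont_exp | apply cont_mult | apply cont_minus
  | apply cont_plus | apply cont_const | apply cont_cos | apply cont_min
  | (apply cont_psum; intros ? ?) ].

(** * Covering by intervals *)

Definition outer_le (A : R -> Prop) (e : R) : Prop :=
  exists a b : nat -> R,
    (forall i, a i <= b i) /\
    (forall x, A x -> exists i, a i < x < b i) /\
    (forall m, psum (fun i => b i - a i) m <= e).

Lemma outer_le_null A : (forall e, 0 < e -> outer_le A e) -> lebesgue_null A.
Proof.
  intros H e He. destruct (H e He) as (a & b & H1 & H2 & H3).
  exists a, b. repeat split; auto. intros m. rewrite psum_sum_f_R0. auto.
Qed.

Lemma null_outer_le A e : lebesgue_null A -> 0 < e -> outer_le A e.
Proof.
  intros H He. destruct (H e He) as (a & b & H1 & H2 & H3).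
  exists a, b. repeat split; auto. intros [|m]; [simpl; lra|]. rewrite <- psum_sum_f_R0. auto.
Qed.

Lemma outer_le_mono (A B : R -> Prop) e e' :
  (forall x, A x -> B x) -> e <= e' -> outer_le B e -> outer_le A e'.
Proof.
  intros H He (a & b & H1 & H2 & H3). exists a, b. repeat split; auto.
  intros m; specialize (H3 m); lra.
Qed.

Lemma lebesgue_null_mono (A B : R -> Prop) :
  (forall x, A x -> B x) -> lebesgue_null B -> lebesgue_null A.
Proof.
  intros H HB. apply outer_le_null. intros e He.
  apply outer_le_mono with B e; auto; [lra|]. apply null_outer_le; auto.
Qed.

Lemma psum_injective (s : nat -> nat) g N M :
  (forall i j, s i = s j -> i = j) -> (forall i, (i < N)%nat -> (s i < M)%nat) ->
  (forall m, 0 <= g m) -> psum (fun i => g (s i)) N <= psum g M.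
Proof.
  intros Hs HM Hg.
  (* Unit weights turn the left side into a sum against [push s 1], whose values are 0 or 1 by
     injectivity. *)
  rewrite (psum_ext _ (fun i => 1 * g (s i))) by (intros; ring).
  rewrite <- (push_spec s (fun _ => 1) N M g HM).
  apply psum_le. intros m _. pose proof (Hg m).
  destruct (push_cases s (fun _ => 1) N m Hs) as [->|(i & _ & _ & ->)]; lra.
Qed.

Lemma psum_grid (f : nat -> nat -> R) M N :
  psum (fun k => f (k / N)%nat (k mod N)%nat) (M * N) = psum (fun i => psum (f i) N) M.
Proof.
  destruct (Nat.eq_dec N 0) as [->|HN].
  { rewrite Nat.mul_0_r. simpl. rewrite psum_const. lra. }
  induction M as [|M IH]; [reflexivity|].
  replace (S M * N)%nat with (M * N + N)%nat by lia.
  rewrite psum_split, IH. simpl. f_equal. apply psum_ext. intros i Hi.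
  f_equal.
  - rewrite Nat.div_add_l, Nat.div_small; auto; lia.
  - rewrite Nat.add_comm, Nat.Div0.mod_add, Nat.mod_small; auto.
Qed.

Lemma psum_cantor (g : nat -> nat -> R) m :
  (forall i j, 0 <= g i j) ->
  psum (fun k => g (fst (of_nat k)) (snd (of_nat k))) m <= psum (fun i => psum (g i) m) m.
Proof.
  intros Hg. rewrite <- psum_grid.
  (* The first [m] Cantor pairs lie in the [m] by [m] square, which is numbered row by row. The
     values [m * m + k] beyond it only keep [s] injective on all of [nat]. *)
  set (s := fun k => if lt_dec k m
     then (fst (of_nat k) * m + snd (of_nat k))%nat else (m * m + k)%nat).
  assert (Hb : forall k, (fst (of_nat k) <= k /\ snd (of_nat k) <= k)%nat).
  { intros k. destruct (of_nat k) as [x y] eqn:e. simpl.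
    pose proof (to_nat_non_decreasing x y). rewrite <- e, cancel_to_of in H. lia. }
  assert (Hd : forall k, (k < m)%nat -> (s k / m = fst (of_nat k) /\ s k mod m = snd (of_nat k))%nat).
  { intros k Hk. unfold s. destruct (lt_dec k m); [|lia]. destruct (Hb k).
    split.
    - rewrite Nat.div_add_l, Nat.div_small; lia.
    - rewrite Nat.add_comm, Nat.Div0.mod_add, Nat.mod_small; lia. }
  assert (Hlt : forall k, (k < m)%nat -> (s k < m * m)%nat).
  { intros k Hk. unfold s. destruct (lt_dec k m); [|lia]. destruct (Hb k). nia. }
  rewrite (psum_ext _ (fun k => (fun q => g (q / m)%nat (q mod m)%nat) (s k))).
  2:{ intros k Hk. simpl. destruct (Hd k Hk) as [-> ->]. reflexivity. }
  apply (psum_injective s (fun q => g (q / m)%nat (q mod m)%nat)).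
  - intros i j Hij. destruct (lt_dec i m) as [hi|hi], (lt_dec j m) as [hj|hj].
    + destruct (Hd i hi), (Hd j hj). apply of_nat_inj.
      rewrite (surjective_pairing (of_nat i)), (surjective_pairing (of_nat j)). congruence.
    + pose proof (Hlt i hi). unfold s in Hij, H.
      destruct (lt_dec i m), (lt_dec j m); lia.
    + pose proof (Hlt j hj). unfold s in Hij, H.
      destruct (lt_dec i m), (lt_dec j m); lia.
    + unfold s in Hij. destruct (lt_dec i m), (lt_dec j m); lia.
  - exact Hlt.
  - intros; apply Hg.
Qed.

Lemma outer_le_union (A : nat -> R -> Prop) (e : nat -> R) c :
  (forall i, outer_le (A i) (e i)) -> (forall m, psum e m <= c) ->
  outer_le (fun x => exists i, A i x) c.
Proof.
  intros HA Hc.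
  assert (Ha : forall i, {ab : (nat -> R) * (nat -> R) |
    (forall j, fst ab j <= snd ab j) /\
    (forall x, A i x -> exists j, fst ab j < x < snd ab j) /\
    (forall m, psum (fun j => snd ab j - fst ab j) m <= e i)}).
  { intros i. apply constructive_indefinite_description.
    destruct (HA i) as (a & b & H). exists (a, b). exact H. }
  set (a := fun i => fst (proj1_sig (Ha i))). set (b := fun i => snd (proj1_sig (Ha i))).
  exists (fun k => a (fst (of_nat k)) (snd (of_nat k))),
         (fun k => b (fst (of_nat k)) (snd (of_nat k))).
  repeat split.
  - intros k. apply (proj2_sig (Ha (fst (of_nat k)))).
  - intros x [i Hx]. destruct (proj1 (proj2 (proj2_sig (Ha i))) x Hx) as [j Hj].
    exists (to_nat (i, j)). rewrite cancel_of_to. exact Hj.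
  - intros m.
    rewrite (psum_cantor (fun i j => b i j - a i j)).
    + rewrite <- (Hc m). apply psum_le. intros i _. apply (proj2_sig (Ha i)).
    + intros i j. pose proof (proj1 (proj2_sig (Ha i)) j). unfold a, b. lra.
Qed.

Lemma psum_half_pow e m : 0 < e -> psum (fun i => e * (/2) ^ S i) m <= e.
Proof.
  intros He. assert (psum (fun i => e * (/2) ^ S i) m = e - e * (/2) ^ m).
  { induction m as [|m IH]; [simpl; lra|].
    change (psum (fun i => e * (/2) ^ S i) m + e * (/2) ^ S m = e - e * (/2) ^ S m).
    rewrite IH. simpl. lra. }
  rewrite H. pose proof (pow_le (/2) m ltac:(lra)). nra.
Qed.

Lemma lebesgue_null_union (A : nat -> R -> Prop) :
  (forall i, lebesgue_null (A i)) -> lebesgue_null (fun x => exists i, A i x).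
Proof.
  intros H. apply outer_le_null. intros e He.
  apply outer_le_union with (fun i => e * (/2) ^ S i).
  - intros i. apply null_outer_le; auto. apply Rmult_lt_0_compat; auto. apply pow_lt; lra.
  - intros m. apply psum_half_pow; auto.
Qed.

Lemma RInt_cells f n : continuity f ->
  psum (fun i => RInt f (INR i / INR (S n)) (INR (S i) / INR (S n))) (S n) = E f.
Proof.
  intros Hf.
  assert (H : forall m, psum (fun i => RInt f (INR i / INR (S n)) (INR (S i) / INR (S n))) m
     = RInt f 0 (INR m / INR (S n))).
  { induction m as [|m IH].
    - simpl psum. change (INR 0) with 0. unfold Rdiv. rewrite Rmult_0_l, RInt_point. reflexivity.
    - rewrite psum_S, IH. apply (RInt_Chasles f); apply ex_RInt_cont; auto. }
  rewrite H. unfold E. f_equal. field. apply not_0_INR; lia.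
Qed.

(** Markov's inequality for covers. By uniform continuity [[0,1]] splits into cells of length [1/N]
    on which [f] varies by less than 1/2, so a cell that meets [1 <= f] carries an integral of at
    least [1/(2N)]. It is covered by an open interval of length [2/N], half a cell wider on each
    side so as to contain its endpoints; hence the factor 4. Other indices get an empty interval. *)
Lemma outer_le_E f : continuity f -> (forall x, 0 <= f x) ->
  outer_le (fun x => 0 < x < 1 /\ 1 <= f x) (4 * E f).
Proof.
  intros Hf H0.
  destruct (@Heine_cor2 f 0 1 (fun x _ => Hf x) (mkposreal (/2) ltac:(lra))) as [d Hd].
  simpl in Hd.
  destruct (archimed_cor1 d (cond_pos d)) as (n' & Hn' & Hn'0).
  destruct n' as [|n]; [lia|]. clear Hn'0.
  assert (HN : 0 < INR (S n)) by (apply lt_0_INR; lia).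
  set (N := INR (S n)) in *.
  set (hit := fun i => exists x, INR i / N <= x <= INR (S i) / N /\ 0 < x < 1 /\ 1 <= f x).
  set (w := fun i => if lt_dec i (S n) then
     if excluded_middle_informative (hit i) then 1 else 0 else 0).
  assert (Hw : forall i, 0 <= w i).
  { intros i. unfold w. destruct lt_dec; [destruct excluded_middle_informative|]; lra. }
  exists (fun i => (INR i - /2) / N), (fun i => (INR i - /2) / N + w i * (2 / N)).
  assert (H2N : 0 < 2 / N) by (apply Rdiv_lt_0_compat; lra).
  repeat split.
  - intros i. pose proof (Hw i). nra.
  - intros x [Hx Hfx].
    destruct (archimed (x * N)) as [Ha1 Ha2].
    assert (0 < x * N) by (apply Rmult_lt_0_compat; lra).
    assert (Hup : (0 < up (x * N))%Z) by (apply lt_IZR; simpl; lra).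
    set (i := Z.to_nat (up (x * N) - 1)).
    assert (Hi : INR i = IZR (up (x * N)) - 1).
    { unfold i. rewrite INR_IZR_INZ, Z2Nat.id by lia. rewrite minus_IZR. simpl. lra. }
    assert (Hi1 : INR i <= x * N) by lra.
    assert (Hi2 : x * N < INR i + 1) by lra.
    assert (Hin : (i < S n)%nat).
    { apply INR_lt. fold N. nra. }
    exists i.
    assert (Hwi : w i = 1).
    { unfold w. destruct lt_dec; [|lia]. destruct excluded_middle_informative as [|h]; [lra|].
      exfalso; apply h. exists x. repeat split; try tauto; try lra.
      - apply Rmult_le_reg_r with N; auto. unfold Rdiv.
        rewrite Rmult_assoc, Rinv_l, Rmult_1_r; lra.
      - apply Rmult_le_reg_r with N; auto. unfold Rdiv.
        rewrite Rmult_assoc, Rinv_l, Rmult_1_r; [rewrite S_INR|]; lra. }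
    rewrite Hwi. split.
    + apply Rmult_lt_reg_r with N; auto. unfold Rdiv. rewrite Rmult_assoc, Rinv_l, Rmult_1_r; lra.
    + apply Rmult_lt_reg_r with N; auto.
      replace (((INR i - / 2) / N + 1 * (2 / N)) * N) with (INR i + 3 / 2) by (field; lra). lra.
  - intros m.
    rewrite (psum_ext _ (fun i => 2 / N * w i)) by (intros; ring).
    rewrite psum_scal.
    assert (Hle : psum w m <= psum w (S n)).
    { destruct (le_dec m (S n)); [apply psum_mono; auto|].
      replace m with (S n + (m - S n))%nat by lia. rewrite psum_split.
      rewrite (psum_ext (fun i => w (S n + i)%nat) (fun _ => 0)).
      - rewrite psum_const. lra.
      - intros i _. unfold w. destruct lt_dec; [lia|reflexivity]. }
    assert (Hs : psum (fun i => /2 * / N * w i) (S n) <= E f).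
    { rewrite <- (RInt_cells f n Hf). apply psum_le. intros i Hi. fold N.
      assert (Hcell : INR i / N <= INR (S i) / N).
      { apply Rmult_le_compat_r; [left; apply Rinv_0_lt_compat; auto|]. rewrite S_INR; lra. }
      assert (Hlen : INR (S i) / N - INR i / N = / N) by (rewrite S_INR; field; lra).
      assert (Hcell0 : 0 <= INR i / N).
      { apply Rmult_le_pos; [apply pos_INR|left; apply Rinv_0_lt_compat; auto]. }
      assert (Hcell1 : INR (S i) / N <= 1).
      { apply Rmult_le_reg_r with N; auto. unfold Rdiv. rewrite Rmult_assoc, Rinv_l, Rmult_1_r by lra.
        rewrite Rmult_1_l. apply le_INR. lia. }
      unfold w. destruct lt_dec; [|lia]. destruct excluded_middle_informative as [(y & Hy & Hy' & Hfy)|].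
      - rewrite Rmult_1_r.
        assert (Hr : / 2 * / N = RInt (fun _ => / 2) (INR i / N) (INR (S i) / N)).
        { rewrite RInt_const_R, Hlen. ring. }
        rewrite Hr.
        apply RInt_le; auto using ex_RInt_cont, cont_const.
        intros z Hz.
        assert (Rabs (y - z) < d) by (apply Rabs_def1; lra).
        specialize (Hd y z ltac:(lra) ltac:(lra) H). apply Rabs_def2 in Hd. lra.
      - rewrite Rmult_0_r. apply RInt_ge_0; auto using ex_RInt_cont. }
    rewrite psum_scal in Hs.
    replace (2 / N * psum w m) with (4 * (/ 2 * / N * psum w m)) by (field; lra).
    assert (0 < / N) by (apply Rinv_0_lt_compat; auto). nra.
Qed.

Lemma null_of_E (A : R -> Prop) :
  (forall e, 0 < e -> exists f, continuity f /\ (forall x, 0 <= f x) /\ E f <= e /\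
     forall x, A x -> 1 <= f x) ->
  lebesgue_null (fun x => 0 < x < 1 /\ A x).
Proof.
  intros H. apply outer_le_null. intros e He.
  destruct (H (e / 4) ltac:(lra)) as (f & H1 & H2 & H3 & H4).
  apply outer_le_mono with (fun x => 0 < x < 1 /\ 1 <= f x) (4 * E f).
  - intros x [? ?]; auto.
  - lra.
  - apply outer_le_E; auto.
Qed.

Lemma borel_cantelli (F : nat -> R -> R) (u : nat -> R) k0 :
  (forall k, continuity (F k)) -> (forall k x, 0 <= F k x) ->
  (forall k, (k0 <= k)%nat -> E (F k) <= u k) -> ex_series u ->
  lebesgue_null (fun x => 0 < x < 1 /\ forall k1, exists k, (k1 <= k)%nat /\ 1 <= F k x).
Proof.
  intros Hc H0 Hu Hs. apply outer_le_null. intros e He.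
  destruct (Cauchy_ex_series u Hs (mkposreal (e / 4) ltac:(lra))) as [k1 Hk1]. simpl in Hk1.
  set (k := Nat.max k0 k1).
  assert (Ht : forall m, psum (fun i => E (F (k + i)%nat)) m <= e / 4).
  { intros m. apply Rle_trans with (psum (fun i => u (k + i)%nat) m).
    - apply psum_le. intros. apply Hu. lia.
    - destruct m as [|m]; [simpl; lra|].
      specialize (Hk1 k (k + m)%nat ltac:(lia) ltac:(lia)).
      assert (Hn : forall m, sum_n_m u k (k + m) = psum (fun i => u (k + i)%nat) (S m)).
      { clear. induction m as [|m IH].
        - rewrite Nat.add_0_r, sum_n_n. simpl. rewrite Nat.add_0_r. lra.
        - replace (k + S m)%nat with (S (k + m)) by lia.
          rewrite sum_n_Sm by lia. rewrite IH. simpl. replace (k + S m)%nat with (S (k + m)) by lia.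
          reflexivity. }
      rewrite Hn in Hk1. unfold norm in Hk1; simpl in Hk1. unfold abs in Hk1; simpl in Hk1.
      apply Rabs_def2 in Hk1. simpl. lra. }
  apply outer_le_mono with
    (fun x => exists i, 0 < x < 1 /\ 1 <= F (k + i)%nat x) e; [|lra|].
  - intros x [Hx H]. destruct (H k) as (j & Hj & HF). exists (j - k)%nat.
    replace (k + (j - k))%nat with j by lia. auto.
  - apply (outer_le_union _ (fun i => 4 * E (F (k + i)%nat))).
    + intros i. apply outer_le_E; auto.
    + intros m. rewrite psum_scal. specialize (Ht m). lra.
Qed.

(** * Cosine polynomials *)

Definition cosf (m : nat) (x : R) : R := cos (2 * PI * INR m * x).

Lemma cont_cosf m : continuity (cosf m).
Proof. apply cont_cos. Qed.

Lemma cosf_0 x : cosf 0 x = 1.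
Proof. unfold cosf. rewrite <- cos_0. f_equal. simpl. ring. Qed.

Lemma cosf_mult a b x : (a <= b)%nat ->
  cosf a x * cosf b x = / 2 * cosf (a + b) x + / 2 * cosf (b - a) x.
Proof.
  intros H. unfold cosf. rewrite plus_INR, minus_INR by auto.
  replace (2 * PI * (INR a + INR b) * x) with (2 * PI * INR b * x + 2 * PI * INR a * x) by ring.
  replace (2 * PI * (INR b - INR a) * x) with (2 * PI * INR b * x - 2 * PI * INR a * x) by ring.
  rewrite cos_plus, cos_minus. lra.
Qed.

Lemma E_cosf m : (0 < m)%nat -> E (cosf m) = 0.
Proof.
  intros Hm. assert (Hp : 0 < 2 * PI * INR m).
  { pose proof PI_RGT_0. pose proof (lt_0_INR m Hm). nra. }
  assert (H : is_RInt (cosf m) 0 1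
    (minus (sin (2 * PI * INR m * 1) / (2 * PI * INR m))
           (sin (2 * PI * INR m * 0) / (2 * PI * INR m)))).
  { apply (is_RInt_derive (fun x => sin (2 * PI * INR m * x) / (2 * PI * INR m)) (cosf m)).
    - intros x _. unfold cosf. auto_derive; auto. field. split; [apply not_0_INR; lia|apply PI_neq0].
    - intros x _. apply continuity_pt_filterlim, cont_cosf. }
  unfold E. rewrite (is_RInt_unique _ _ _ _ H).
  rewrite Rmult_1_r, Rmult_0_r, sin_0.
  replace (2 * PI * INR m) with (0 + 2 * INR m * PI) at 1 by ring.
  rewrite sin_period, sin_0. unfold minus, plus, opp; simpl. lra.
Qed.

(** The span of the cosines with frequencies in [[lo, hi]], closed under pointwise equality so that
    functions can be rewritten without functional extensionality. A positive [lo] excludes a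
    constant term and thus forces mean zero. *)
Inductive cosp (lo hi : nat) : (R -> R) -> Prop :=
| cosp_zero : cosp lo hi (fun _ => 0)
| cosp_cons f c m : (lo <= m <= hi)%nat -> cosp lo hi f ->
    cosp lo hi (fun x => f x + c * cosf m x)
| cosp_ext f g : (forall x, f x = g x) -> cosp lo hi f -> cosp lo hi g.

Lemma cosp_cont lo hi f : cosp lo hi f -> continuity f.
Proof.
  induction 1 as [|f c m _ _ IH|f g Hfg _ IH].
  - apply cont_const.
  - apply cont_plus; auto. apply cont_mult; [apply cont_const|apply cont_cosf].
  - apply cont_ext with f; auto.
Qed.

Lemma cosp_E0 lo hi f : (0 < lo)%nat -> cosp lo hi f -> E f = 0.
Proof.
  intros Hlo. induction 1 as [|f c m Hm Hf IH|f g Hfg Hf IH].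
  - apply E_const.
  - rewrite E_plus, E_scal, IH, E_cosf by
      (try lia; eauto using cosp_cont, cont_cosf, cont_mult, cont_const). lra.
  - rewrite <- IH. symmetry. apply E_ext; auto.
Qed.

Lemma cosp_weaken lo hi lo' hi' f :
  (lo' <= lo)%nat -> (hi <= hi')%nat -> cosp lo hi f -> cosp lo' hi' f.
Proof.
  intros H1 H2. induction 1 as [|f c m Hm Hf IH|f g Hfg Hf IH].
  - apply cosp_zero.
  - apply cosp_cons; auto; lia.
  - apply cosp_ext with f; auto.
Qed.

Lemma cosp_plus lo hi f g :
  cosp lo hi f -> cosp lo hi g -> cosp lo hi (fun x => f x + g x).
Proof.
  intros Hf. induction 1 as [|g c m Hm Hg IH|g g' Hgg Hg IH].
  - apply cosp_ext with f; auto. intros; ring.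
  - apply cosp_ext with (fun x => (f x + g x) + c * cosf m x); [intros; ring|].
    apply cosp_cons; auto.
  - apply cosp_ext with (fun x => f x + g x); auto. intros; rewrite Hgg; auto.
Qed.

Lemma cosp_scal lo hi c f : cosp lo hi f -> cosp lo hi (fun x => c * f x).
Proof.
  induction 1 as [|f d m Hm Hf IH|f g Hfg Hf IH].
  - apply cosp_ext with (fun _ => 0); [intros; ring|apply cosp_zero].
  - apply cosp_ext with (fun x => c * f x + (c * d) * cosf m x); [intros; ring|].
    apply cosp_cons; auto.
  - apply cosp_ext with (fun x => c * f x); auto. intros; rewrite Hfg; auto.
Qed.

Lemma cosp_mono lo hi c m : (lo <= m <= hi)%nat -> cosp lo hi (fun x => c * cosf m x).
Proof.
  intros H. apply cosp_ext with (fun x => 0 + c * cosf m x); [intros; ring|].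
  apply cosp_cons; auto. apply cosp_zero.
Qed.

Lemma cosp_mult_cosf lo hi f m : (hi <= m)%nat -> cosp lo hi f ->
  cosp (m - hi) (hi + m) (fun x => f x * cosf m x).
Proof.
  intros Hm. induction 1 as [|f c k Hk Hf IH|f g Hfg Hf IH].
  - apply cosp_ext with (fun _ => 0); [intros; ring|apply cosp_zero].
  - apply cosp_ext with
      (fun x => f x * cosf m x + (c / 2 * cosf (k + m) x + c / 2 * cosf (m - k) x)).
    + intros x. rewrite Rmult_plus_distr_r, Rmult_assoc, cosf_mult by lia. lra.
    + apply cosp_plus; auto. apply cosp_plus; apply cosp_mono; lia.
  - apply cosp_ext with (fun x => f x * cosf m x); auto. intros; rewrite Hfg; auto.
Qed.

(** Product-to-sum produces sums and differences of frequencies; [hi <= lo'] makes the truncated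
    subtraction a true one. If [hi < lo'], the product has no constant term. *)
Lemma cosp_mult lo hi lo' hi' f g : (hi <= lo')%nat ->
  cosp lo hi f -> cosp lo' hi' g -> cosp (lo' - hi) (hi + hi') (fun x => f x * g x).
Proof.
  intros H Hf. induction 1 as [|g c k Hk Hg IH|g g' Hgg Hg IH].
  - apply cosp_ext with (fun _ => 0); [intros; ring|apply cosp_zero].
  - apply cosp_ext with (fun x => f x * g x + c * (f x * cosf k x)); [intros; ring|].
    apply cosp_plus; auto. apply cosp_scal.
    apply cosp_weaken with (k - hi)%nat (hi + k)%nat; try lia.
    apply cosp_mult_cosf with lo; auto; lia.
  - apply cosp_ext with (fun x => f x * g x); auto. intros; rewrite Hgg; auto.
Qed.

(** * Exact mean of a product over separated blocks *)

Fixpoint pprod (f : nat -> R) (N : nat) : R :=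
  match N with O => 1 | S m => pprod f m * f m end.

Definition blk (n : nat -> nat) (c : nat -> R) (s l : nat) (x : R) : R :=
  psum (fun u => c (s + u)%nat * cosf (n (s + u)%nat) x) l.

Definition blkV (c : nat -> R) (s l : nat) : R := psum (fun u => Rsqr (c (s + u)%nat)) l.

Definition quad (x : R) : R := 1 + x + x * x / 2.

(** In the square of a block sum the diagonal gives [V/2] plus doubled frequencies, and the
    off-diagonal terms give sums and differences of frequencies, all above [D] by the separation
    assumption. Here [D] will be the degree of the product of the earlier factors; separation is
    asked only at nonzero coefficients, so the gaps are exempt. *)
Lemma blk_cosp n c s l D hi :
  (forall u, (u < l)%nat -> c (s + u)%nat <> 0 -> (D < n (s + u))%nat /\
     forall v, (v < u)%nat -> (D + n (s + v) < n (s + u))%nat) ->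
  (forall u, (u < l)%nat -> (n (s + u) <= hi)%nat) ->
  cosp (S D) hi (blk n c s l) /\
  cosp (S D) (2 * hi) (fun x => blk n c s l x * blk n c s l x - blkV c s l / 2).
Proof.
  intros H Hhi. unfold blk, blkV. induction l as [|l IH].
  { simpl. split; [apply cosp_zero|].
    apply cosp_ext with (fun _ => 0); [intros; lra|apply cosp_zero]. }
  destruct IH as [IH1 IH2].
  { intros; apply H; auto; lia. } { intros; apply Hhi; auto; lia. }
  rewrite psum_S. set (d := c (s + l)%nat) in *. set (m := n (s + l)%nat) in *.
  destruct (Req_dec d 0) as [Hd|Hd].
  - rewrite Hd, Rsqr_0. split.
    + eapply cosp_ext; [|exact IH1]. intros x. rewrite psum_S. fold d m. rewrite Hd. ring.
    + eapply cosp_ext; [|exact IH2]. intros x. rewrite psum_S. fold d m. rewrite Hd. simpl. lra.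
  - destruct (H l ltac:(lia) Hd) as [H1 H2]. fold m in H1, H2.
    pose proof (Hhi l ltac:(lia)) as Hm. fold m in Hm.
    split.
    + apply cosp_cons; auto.
    + apply cosp_ext with (fun x =>
        (psum (fun u => c (s + u)%nat * cosf (n (s + u)%nat) x) l *
         psum (fun u => c (s + u)%nat * cosf (n (s + u)%nat) x) l
         - psum (fun u => Rsqr (c (s + u)%nat)) l / 2)
        + (2 * d * (psum (fun u => c (s + u)%nat * cosf (n (s + u)%nat) x) l * cosf m x)
           + d * d / 2 * cosf (m + m) x)).
      { intros x. rewrite psum_S. fold d m.
        pose proof (cosf_mult m m x (le_n _)) as Hc. rewrite Nat.sub_diag, cosf_0 in Hc.
        unfold Rsqr. nra. }
      apply cosp_plus; [exact IH2|]. apply cosp_plus.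
      * apply cosp_scal.
        (* Every earlier active frequency is more than [D] below [m], so multiplication by [cosf m]
           leaves only frequencies of at least [S D]. *)
        assert (Hlow : cosp (S D) (m - S D)
          (fun x => psum (fun u => c (s + u)%nat * cosf (n (s + u)%nat) x) l)).
        { clear IH1 IH2.
          assert (Hsub : forall v, (v <= l)%nat -> cosp (S D) (m - S D)
            (fun x => psum (fun u => c (s + u)%nat * cosf (n (s + u)%nat) x) v)).
          { induction v as [|v IHv]; intros Hv; simpl; [apply cosp_zero|].
            destruct (Req_dec (c (s + v)%nat) 0) as [Hz|Hz].
            - apply cosp_ext with (fun x => psum (fun u => c (s + u)%nat * cosf (n (s + u)%nat) x) v).
              + intros; rewrite Hz; ring.
              + apply IHv; lia.
            - apply cosp_cons; [|apply IHv; lia].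
              destruct (H v ltac:(lia) Hz). specialize (H2 v ltac:(lia)). lia. }
          apply Hsub; auto. }
        apply cosp_weaken with (m - (m - S D))%nat (m - S D + m)%nat; try lia.
        apply cosp_mult_cosf with (S D); auto. lia.
      * apply cosp_mono. lia.
Qed.

Section Lacunary.
Context (n : nat -> nat) (q : R) (Hgap : hadamard_gap n q).

Lemma gap_pos m : 0 < INR (n m).
Proof. apply lt_0_INR, Hgap. Qed.

Lemma gap_step m : q * INR (n m) <= INR (n (S m)).
Proof.
  destruct Hgap as (_ & _ & H). specialize (H m). pose proof (gap_pos m).
  replace (INR (n (S m))) with (INR (n (S m)) / INR (n m) * INR (n m)) by (field; lra). nra.
Qed.

Lemma gap_pow m k : q ^ k * INR (n m) <= INR (n (m + k)).
Proof.
  destruct Hgap as (Hq & _ & _).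
  induction k as [|k IH]; [rewrite Nat.add_0_r; simpl; lra|].
  replace (m + S k)%nat with (S (m + k)) by lia. pose proof (gap_step (m + k)).
  simpl. nra.
Qed.

Lemma gap_le m k : (m <= k)%nat -> INR (n m) <= INR (n k).
Proof.
  intros H. destruct Hgap as (Hq & _ & _). replace k with (m + (k - m))%nat by lia.
  pose proof (gap_pow m (k - m)). pose proof (pow_R1_Rle q (k - m) ltac:(lra)).
  pose proof (gap_pos m). nra.
Qed.

Lemma gap_diff v u : (v < u)%nat -> q * INR (n v) <= INR (n u).
Proof.
  intros H. apply Rle_trans with (INR (n (S v))); [apply gap_step|apply gap_le; lia].
Qed.

Context (r : nat) (Hr : 3 + 3 / (q - 1) < q ^ r).

(** The bound in [Hr] equals [3q/(q-1)]. After [r] skipped indices a frequency exceeds [3q/(q-1)]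
    times [n (s j)]; the difference of two frequencies of a block is at least [1 - 1/q] times the
    larger one, hence above [3 * n (s j)], which bounds the degree of all earlier factors. *)
Lemma block_prod (c : nat -> R) (s : nat -> nat) (J : nat) :
  s 0%nat = 0%nat -> (forall j, (s j <= s (S j))%nat) ->
  (forall j, (1 <= j)%nat -> (s j + r <= s (S j))%nat) ->
  (forall j m, (1 <= j)%nat -> (s j <= m < s j + r)%nat -> c m = 0) ->
  let F := fun x => pprod (fun j => quad (blk n c (s j) (s (S j) - s j) x)) J in
  continuity F /\ E F = pprod (fun j => 1 + blkV c (s j) (s (S j) - s j) / 4) J.
Proof.
  intros Hs0 Hs Hsr Hc. simpl. destruct Hgap as (Hq & Hpos & _).
  assert (Hq3 : 3 < q ^ r /\ 3 * q < (q - 1) * q ^ r).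
  { assert (0 < 3 / (q - 1)) by (apply Rdiv_lt_0_compat; lra).
    split; [lra|].
    replace (3 * q) with ((q - 1) * (3 + 3 / (q - 1))) by (field; lra).
    apply Rmult_lt_compat_l; lra. }
  (* Invariant: the product has degree at most [3 * n (s J)]. The new factor adds at most
     [2 * n (s (S J))], and [3 < q ^ r] keeps the old degree below [n (s (S J))]. The empty product
     has degree 0, so the first block needs no leading gap. *)
  assert (H : exists D, cosp 0 D (fun x => pprod (fun j => quad (blk n c (s j) (s (S j) - s j) x)) J)
    /\ (J = 0%nat /\ D = 0%nat \/ (1 <= J)%nat /\ (D <= 3 * n (s J))%nat)
    /\ E (fun x => pprod (fun j => quad (blk n c (s j) (s (S j) - s j) x)) J) =
       pprod (fun j => 1 + blkV c (s j) (s (S j) - s j) / 4) J).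
  2:{ destruct H as (D & H1 & _ & H2). split; [eapply cosp_cont; eauto|exact H2]. }
  induction J as [|J (D & HP & HD & HE)].
  - exists 0%nat. repeat split; auto; simpl.
    + apply cosp_ext with (fun x => 1 * cosf 0 x); [intros; rewrite cosf_0; ring|].
      apply cosp_mono; lia.
    + apply E_const.
  - set (a := s J) in *. set (l := (s (S J) - a)%nat).
    assert (Hal : s (S J) = (a + l)%nat) by (unfold l, a; specialize (Hs J); lia).
    destruct (blk_cosp n c a l D (n (s (S J)))) as [HU HU2].
    { intros u Hu Hcu.
      destruct HD as [[HJ HD]|[HJ HD]].
      - subst D. split; [apply Hpos|]. intros v Hv. simpl. apply INR_lt.
        pose proof (gap_diff (a + v) (a + u) ltac:(lia)). pose proof (gap_pos (a + v)). nra.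
      - assert (Hur : (r <= u)%nat).
        { destruct (le_lt_dec r u) as [|h]; auto. exfalso. apply Hcu.
          apply (Hc J); auto. fold a. lia. }
        apply le_INR in HD. rewrite mult_INR in HD. simpl INR in HD.
        pose proof (gap_pow a u) as Hau. pose proof (gap_pos a) as Ha.
        pose proof (Rle_pow q r u ltac:(lra) Hur) as Hru.
        assert (q ^ r * INR (n a) <= INR (n (a + u))) by nra.
        split.
        + apply INR_lt. nra.
        + intros v Hv. apply INR_lt. rewrite plus_INR.
          pose proof (gap_diff (a + v) (a + u) ltac:(lia)) as Hvu.
          assert (3 * q * INR (n a) < (q - 1) * INR (n (a + u))) by nra.
          assert (q * (INR D + INR (n (a + v))) < q * INR (n (a + u))) by nra.
          nra. }
    { intros u Hu. rewrite Hal. apply INR_le. apply gap_le. lia. }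
    set (U := blk n c a l) in *. set (V := blkV c a l) in *.
    set (P := fun x => pprod (fun j => quad (blk n c (s j) (s (S j) - s j) x)) J) in *.
    set (h := n (s (S J))) in *.
    (* [quad U] is [1 + V/4] plus [H], and all frequencies of [H] exceed the degree of [P], so
       [P * H] has mean zero. *)
    set (H := fun x => U x + / 2 * (U x * U x - V / 2)).
    assert (HH : cosp (S D) (2 * h) H).
    { apply cosp_plus; [apply cosp_weaken with (S D) h; auto; lia|]. apply cosp_scal; auto. }
    assert (HPH : cosp 1 (D + 2 * h) (fun x => P x * H x)).
    { apply cosp_weaken with (S D - D)%nat (D + 2 * h)%nat; try lia.
      apply cosp_mult with 0%nat; auto. }
    assert (HF : forall x, pprod (fun j => quad (blk n c (s j) (s (S j) - s j) x)) (S J)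
      = (1 + V / 4) * P x + P x * H x).
    { intros x. simpl. fold (P x). fold a l. change (blk n c a l x) with (U x).
      unfold quad, H. lra. }
    exists (D + 2 * h)%nat. repeat split.
    + apply cosp_ext with (fun x => (1 + V / 4) * P x + P x * H x); [intros; auto|].
      apply cosp_plus; [|apply cosp_weaken with 1%nat (D + 2 * h)%nat; auto; lia].
      apply cosp_scal. apply cosp_weaken with 0%nat D; auto; lia.
    + right. split; [lia|]. fold h. destruct HD as [[_ HD]|[HJ HD]]; [lia|].
      assert (3 * n a <= h)%nat; [|lia].
      apply INR_le. rewrite mult_INR. simpl INR. unfold h. rewrite Hal.
      specialize (Hsr J HJ). fold a in Hsr.
      pose proof (gap_pow a r). pose proof (gap_le (a + r) (a + l) ltac:(lia)).
      pose proof (gap_pos a). nra.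
    + rewrite (E_ext _ _ HF). rewrite E_plus, E_scal, (cosp_E0 _ _ _ (Nat.lt_0_1) HPH), HE.
      * simpl. fold a l. fold V. ring.
      * eapply cosp_cont; eauto.
      * apply cont_mult; [apply cont_const|eapply cosp_cont; eauto].
      * eapply cosp_cont; eauto.
Qed.

End Lacunary.

(** * Moment generating functions *)

Lemma quad_pos x : 0 < quad x.
Proof. unfold quad. nra. Qed.

Lemma exp_le a b : a <= b -> exp a <= exp b.
Proof. intros [h| ->]; [left; apply exp_increasing; auto|lra]. Qed.

Lemma exp_half_le : exp (/ 2) <= 9 / 5.
Proof.
  pose proof exp_le_3 as H. replace 1 with (/ 2 + / 2) in H by lra.
  rewrite exp_plus in H. pose proof (exp_pos (/ 2)). nra.
Qed.

(** The derivative of [exp (-t) * quad t] is [- exp (-t) * t^2 / 2], so [exp (-x) * quad x] differs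
    from 1 by a cubic term; its constant 9/10 is half of the bound 9/5 for [exp (1/2)]. *)
Lemma quad_exp_bounds x y : Rabs x <= / 2 -> Rabs x * Rabs x * Rabs x <= y ->
  exp x <= quad x * exp (2 * y) /\ quad x * exp (- y) <= exp x.
Proof.
  intros Hx Hy.
  set (z := Rabs x * Rabs x * Rabs x) in *.
  assert (Hg : Rabs (exp (- x) * quad x - 1) <= 9 / 10 * z).
  { destruct (MVT_gen (fun t => exp (- t) * quad t) 0 x (fun t => - (exp (- t) * (t * t) / 2)))
      as (t & Ht & He).
    - intros t _. unfold quad. auto_derive; auto. field.
    - intros t _. apply derivable_continuous_pt. unfold quad. reg.
    - assert (Ht' : Rabs t <= Rabs x).
      { unfold Rabs, Rmin, Rmax in *. destruct (Rle_dec 0 x), (Rcase_abs t), (Rcase_abs x); lra. }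
      replace (exp (- x) * quad x - 1) with (exp (- x) * quad x - exp (- 0) * quad 0).
      2:{ unfold quad. rewrite Ropp_0, exp_0. lra. }
      rewrite He, Rminus_0_r, Rabs_mult, Rabs_Ropp.
      assert (Hexp : exp (- t) <= 9 / 5).
      { apply Rle_trans with (exp (/ 2)); [|exact exp_half_le].
        assert (- t <= / 2) by (pose proof (Rle_abs (- t)); rewrite Rabs_Ropp in *; lra).
        apply exp_le; auto. }
      assert (Htt : t * t <= Rabs x * Rabs x).
      { rewrite <- (Rabs_pos_eq (t * t)) by nra. rewrite Rabs_mult.
        pose proof (Rabs_pos t). nra. }
      pose proof (exp_pos (- t)).
      rewrite Rabs_pos_eq by nra. unfold z. pose proof (Rabs_pos x).
      replace (9 / 10 * (Rabs x * Rabs x * Rabs x))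
        with ((9 / 5 * (Rabs x * Rabs x) / 2) * Rabs x) by lra.
      apply Rmult_le_compat_r; auto. nra. }
  assert (Hz : 0 <= z) by (unfold z; pose proof (Rabs_pos x); nra).
  assert (Hz8 : z <= / 8).
  { unfold z. pose proof (Rabs_pos x).
    assert (Rabs x * Rabs x <= / 4) by nra. nra. }
  assert (Hxx : exp x * exp (- x) = 1).
  { rewrite <- exp_plus. replace (x + - x) with 0 by ring. apply exp_0. }
  pose proof (exp_pos x) as Hpx. apply Rabs_le_between in Hg.
  pose proof (quad_pos x) as Hq.
  split.
  - apply Rle_trans with (quad x * exp (2 * z)).
    2:{ apply Rmult_le_compat_l; [lra|]. apply exp_le. lra. }
    replace (quad x) with (exp x * (exp (- x) * quad x)) by (rewrite <- Rmult_assoc, Hxx; ring).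
    pose proof (exp_ineq1_le (2 * z)).
    assert (1 <= (exp (- x) * quad x) * exp (2 * z)) by nra.
    rewrite Rmult_assoc. nra.
  - apply Rle_trans with (quad x * exp (- z)).
    { apply Rmult_le_compat_l; [lra|]. apply exp_le. lra. }
    replace (quad x) with (exp x * (exp (- x) * quad x)) by (rewrite <- Rmult_assoc, Hxx; ring).
    pose proof (exp_ineq1_le z). pose proof (exp_pos (- z)).
    assert (exp z * exp (- z) = 1) by (rewrite <- exp_plus; replace (z + - z) with 0 by ring; apply exp_0).
    assert ((exp (- x) * quad x) * exp (- z) <= 1) by nra.
    rewrite Rmult_assoc. nra.
Qed.

(** Follows from [(1 + y)(1 - y + y^2) = 1 + y^3 >= 1]. It converts the exact product of the factors
    [1 + W/4] into an exponential from below. *)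
Lemma exp_sub_sq_le y : 0 <= y -> exp (y - y * y) <= 1 + y.
Proof.
  intros Hy. pose proof (exp_ineq1_le (- (y - y * y))) as H.
  assert (H1 : exp (y - y * y) * exp (- (y - y * y)) = 1).
  { rewrite <- exp_plus. rewrite Rplus_opp_r. apply exp_0. }
  pose proof (exp_pos (y - y * y)).
  assert ((1 + y) * (1 - y + y * y) >= 1) by nra.
  assert (1 <= (1 + y) * exp (- (y - y * y))) by nra. nra.
Qed.

Lemma pprod_pos f N : (forall i, (i < N)%nat -> 0 < f i) -> 0 < pprod f N.
Proof.
  induction N as [|N IH]; intros H; simpl; [lra|].
  apply Rmult_lt_0_compat; [apply IH; intros|]; apply H; lia.
Qed.

Lemma pprod_le f g N : (forall i, (i < N)%nat -> 0 < f i <= g i) -> pprod f N <= pprod g N.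
Proof.
  induction N as [|N IH]; intros H; simpl; [lra|].
  pose proof (H N ltac:(lia)). pose proof (IH (fun i h => H i ltac:(lia))).
  pose proof (pprod_pos f N (fun i h => proj1 (H i ltac:(lia)))).
  apply Rmult_le_compat; lra.
Qed.

Lemma pprod_mult f g N : pprod (fun i => f i * g i) N = pprod f N * pprod g N.
Proof. induction N; simpl; [lra|rewrite IHN; ring]. Qed.

Lemma pprod_exp f N : pprod (fun i => exp (f i)) N = exp (psum f N).
Proof. induction N; simpl; [symmetry; apply exp_0|rewrite IHN, exp_plus; ring]. Qed.

Lemma psum_sq_le f l : Rsqr (psum f l) <= INR l * psum (fun u => Rsqr (f u)) l.
Proof.
  unfold Rsqr. induction l as [|l IH]; [simpl; lra|].
  rewrite S_INR, !psum_S.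
  set (A := psum f l) in *. set (V := psum (fun u => f u * f u) l) in *. set (a := f l).
  assert (HV : 0 <= V) by (apply psum_ge0; intros; nra).
  pose proof (pos_INR l) as Hl.
  assert (2 * (A * a) <= V + INR l * (a * a)).
  { destruct (Rle_dec (A * a) 0) as [h|h]; [nra|].
    assert ((2 * (A * a)) * (2 * (A * a)) <= (V + INR l * (a * a)) * (V + INR l * (a * a))).
    { assert (A * A * (a * a) <= INR l * V * (a * a)) by nra.
      assert (0 <= (V - INR l * (a * a)) * (V - INR l * (a * a))) by apply Rle_0_sqr. nra. }
    assert (0 <= INR l * (a * a)) by nra. nra. }
  nra.
Qed.

Lemma psum_abs_le f l b : (forall i, (i < l)%nat -> Rabs (f i) <= b) ->
  Rabs (psum f l) <= INR l * b.
Proof.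
  induction l as [|l IH]; intros H; [simpl; rewrite Rabs_R0; lra|].
  rewrite S_INR, psum_S. pose proof (Rabs_triang (psum f l) (f l)).
  pose proof (IH (fun i h => H i ltac:(lia))). pose proof (H l ltac:(lia)). lra.
Qed.

Lemma psum_telescope f s J : s 0%nat = 0%nat -> (forall j, (s j <= s (S j))%nat) ->
  psum f (s J) = psum (fun j => psum (fun u => f (s j + u)%nat) (s (S j) - s j)) J.
Proof.
  intros H0 Hs. induction J as [|J IH]; [rewrite H0; reflexivity|].
  specialize (Hs J). replace (s (S J)) with (s J + (s (S J) - s J))%nat at 1 by lia.
  rewrite psum_split, IH. reflexivity.
Qed.

Section MGF.
Context (n : nat -> nat) (q : R) (Hgap : hadamard_gap n q).
Context (r : nat) (Hr : 3 + 3 / (q - 1) < q ^ r).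

Lemma cosf_abs m x : Rabs (cosf m x) <= 1.
Proof. apply Rabs_le. apply COS_bound. Qed.

Lemma blk_bounds c s l L cs x : (l <= L)%nat -> 0 <= cs ->
  (forall m, Rabs (c m) <= cs) ->
  Rabs (blk n c s l x) <= INR L * cs /\
  Rabs (blk n c s l x) * Rabs (blk n c s l x) <= INR L * blkV c s l.
Proof.
  intros Hl Hcs Hc. apply le_INR in Hl. pose proof (pos_INR l). split.
  - apply Rle_trans with (INR l * cs); [|nra]. apply psum_abs_le. intros i _.
    rewrite Rabs_mult. pose proof (Hc (s + i)%nat). pose proof (cosf_abs (n (s + i)%nat) x).
    pose proof (Rabs_pos (c (s + i)%nat)). pose proof (Rabs_pos (cosf (n (s + i)%nat) x)). nra.
  - rewrite <- Rabs_mult, Rabs_pos_eq by nra.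
    assert (HV : psum (fun u => Rsqr (c (s + u)%nat * cosf (n (s + u)%nat) x)) l <= blkV c s l).
    { apply psum_le. intros i _. unfold Rsqr. pose proof (COS_bound (2 * PI * INR (n (s + i)%nat) * x)).
      unfold cosf. set (t := cos _) in *. assert (t * t <= 1) by nra. nra. }
    pose proof (psum_sq_le (fun u => c (s + u)%nat * cosf (n (s + u)%nat) x) l) as H1.
    unfold Rsqr at 1 in H1.
    assert (0 <= psum (fun u => Rsqr (c (s + u)%nat * cosf (n (s + u)%nat) x)) l).
    { apply psum_ge0. intros; apply Rle_0_sqr. }
    unfold blk. nra.
Qed.

(** The cubic error of a block is at most [(L * W j) * (L * cs)]: Cauchy-Schwarz for two factors,
    the sup bound for the third. Summed over blocks this is [L^2 * cs * V], proportional to [V] and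
    independent of the number of terms. *)
Lemma mgf_blocks c s J L cs :
  s 0%nat = 0%nat -> (forall j, (s j <= s (S j))%nat) ->
  (forall j, (1 <= j)%nat -> (s j + r <= s (S j))%nat) ->
  (forall j m, (1 <= j)%nat -> (s j <= m < s j + r)%nat -> c m = 0) ->
  (forall j, (s (S j) - s j <= L)%nat) ->
  (1 <= L)%nat -> 0 <= cs -> INR L * cs <= / 2 -> (forall m, Rabs (c m) <= cs) ->
  let V := psum (fun m => Rsqr (c m)) (s J) in
  exp (V / 4 - 2 * INR L ^ 2 * cs * V)
    <= E (fun x => exp (psum (fun m => c m * cosf (n m) x) (s J)))
    <= exp (V / 4 + 2 * INR L ^ 2 * cs * V).
Proof.
  intros Hs0 Hs Hsr Hcz Hl HL1 Hcs HLc Hc V.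
  destruct (block_prod n q Hgap r Hr c s J Hs0 Hs Hsr Hcz) as [HF HEF].
  set (U := fun j x => blk n c (s j) (s (S j) - s j) x) in *.
  set (W := fun j => blkV c (s j) (s (S j) - s j)) in *.
  change (E (fun x => pprod (fun j => quad (U j x)) J) = pprod (fun j => 1 + W j / 4) J) in HEF.
  change (continuity (fun x => pprod (fun j => quad (U j x)) J)) in HF.
  assert (HLr : 1 <= INR L) by (apply (le_INR 1); auto).
  assert (HVW : V = psum W J) by (apply psum_telescope; auto).
  assert (HSU : forall x, psum (fun m => c m * cosf (n m) x) (s J) = psum (fun j => U j x) J).
  { intros x. rewrite psum_telescope; auto. }
  assert (HW0 : forall j, 0 <= W j) by (intros j; apply psum_ge0; intros; apply Rle_0_sqr).
  set (K := INR L ^ 2 * cs).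
  assert (HK : 0 <= K) by (unfold K; nra).
  assert (HU : forall j x, exp (U j x) <= quad (U j x) * exp (2 * (K * W j)) /\
      quad (U j x) * exp (- (K * W j)) <= exp (U j x)).
  { intros j x. destruct (blk_bounds c (s j) (s (S j) - s j) L cs x (Hl j) Hcs Hc) as [H1 H2].
    apply quad_exp_bounds; [change (U j x) with (blk n c (s j) (s (S j) - s j) x); lra|].
    change (blk n c (s j) (s (S j) - s j) x) with (U j x) in *. fold (W j) in H2.
    pose proof (Rabs_pos (U j x)). specialize (HW0 j).
    apply Rle_trans with ((INR L * W j) * (INR L * cs)); [|unfold K; nra].
    apply Rmult_le_compat; nra. }
  assert (Hup : forall x, exp (psum (fun j => U j x) J) <=
     exp (2 * K * V) * pprod (fun j => quad (U j x)) J).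
  { intros x. rewrite <- pprod_exp.
    replace (2 * K * V) with (psum (fun j => 2 * (K * W j)) J)
      by (rewrite !psum_scal, HVW; ring).
    rewrite <- pprod_exp, Rmult_comm, <- pprod_mult. apply pprod_le.
    intros j _. split; [apply exp_pos|apply HU]. }
  assert (Hlo : forall x, exp (- K * V) * pprod (fun j => quad (U j x)) J <=
     exp (psum (fun j => U j x) J)).
  { intros x. rewrite <- (pprod_exp (fun j => U j x)).
    replace (- K * V) with (psum (fun j => - K * W j) J)
      by (rewrite !psum_scal, HVW; ring).
    rewrite <- pprod_exp, Rmult_comm, <- pprod_mult. apply pprod_le.
    intros j _. split.
    - apply Rmult_lt_0_compat; [apply quad_pos|apply exp_pos].
    - replace (- K * W j) with (- (K * W j)) by ring. apply HU. }
  rewrite (E_ext _ (fun x => exp (psum (fun j => U j x) J))) by (intros; rewrite HSU; auto).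
  assert (HcU : continuity (fun x => exp (psum (fun j => U j x) J))).
  { apply cont_ext with (fun x => exp (psum (fun m => c m * cosf (n m) x) (s J))).
    - intros; rewrite HSU; auto.
    - apply cont_exp, cont_psum. intros. apply cont_mult; [apply cont_const|apply cont_cosf]. }
  split.
  - apply Rle_trans with (exp (- K * V) * pprod (fun j => 1 + W j / 4) J).
    + assert (HWb : forall j, W j <= INR L * cs * cs).
      { intros j. unfold W, blkV.
        apply Rle_trans with (INR (s (S j) - s j) * (cs * cs)).
        - rewrite <- (psum_const (cs * cs)). apply psum_le. intros u _.
          specialize (Hc (s j + u)%nat). pose proof (Rabs_pos (c (s j + u)%nat)).
          rewrite Rsqr_abs. unfold Rsqr. nra.
        - pose proof (le_INR _ _ (Hl j)). nra. }
      apply Rle_trans with (exp (- K * V) * pprod (fun j => exp (W j / 4 - K * W j)) J).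
      * rewrite pprod_exp, <- exp_plus.
        rewrite (psum_ext _ (fun j => (/ 4 - K) * W j)) by (intros; field).
        rewrite psum_scal, <- HVW. apply exp_le. unfold K. lra.
      * apply Rmult_le_compat_l; [left; apply exp_pos|]. apply pprod_le. intros j _.
        split; [apply exp_pos|]. specialize (HW0 j). specialize (HWb j).
        apply Rle_trans with (exp (W j / 4 - W j / 4 * (W j / 4))).
        (* The quadratic loss [(W/4)^2] is absorbed by [K * W], because [W <= L * cs^2] and
           [L * cs <= 1/2]. *)
        -- apply exp_le. assert (W j / 16 <= K); [|nra]. unfold K. nra.
        -- apply exp_sub_sq_le. lra.
    + rewrite <- HEF, <- E_scal by auto. apply E_le; auto. apply cont_mult; auto using cont_const.
  - apply Rle_trans with (exp (2 * K * V) * pprod (fun j => 1 + W j / 4) J).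
    + rewrite <- HEF, <- E_scal by auto. apply E_le; auto. apply cont_mult; auto using cont_const.
    + apply Rle_trans with (exp (2 * K * V) * pprod (fun j => exp (W j / 4)) J).
      * apply Rmult_le_compat_l; [left; apply exp_pos|]. apply pprod_le. intros j _.
        specialize (HW0 j). split; [lra|]. pose proof (exp_ineq1_le (W j / 4)). lra.
      * rewrite pprod_exp, <- exp_plus.
        rewrite (psum_ext _ (fun j => / 4 * W j)) by (intros; field).
        rewrite psum_scal, <- HVW. apply exp_le. unfold K. lra.
Qed.

Lemma psum_stable f M N : (forall m, (M <= m)%nat -> f m = 0) -> (M <= N)%nat ->
  psum f N = psum f M.
Proof.
  intros H HMN. replace N with (M + (N - M))%nat by lia. rewrite psum_split.
  rewrite (psum_ext (fun i => f (M + i)%nat) (fun _ => 0)).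
  - rewrite psum_const. lra.
  - intros; apply H; lia.
Qed.

Lemma mgf_offset c L o cs M :
  (1 <= L)%nat -> (r <= L)%nat -> (o < L)%nat -> 0 <= cs -> INR L * cs <= / 2 ->
  (forall m, Rabs (c m) <= cs) ->
  (forall m, ((m + o) mod L < r)%nat -> c m = 0) -> (forall m, (M <= m)%nat -> c m = 0) ->
  let V := psum (fun m => Rsqr (c m)) M in
  exp (V / 4 - 2 * INR L ^ 2 * cs * V)
    <= E (fun x => exp (psum (fun m => c m * cosf (n m) x) M))
    <= exp (V / 4 + 2 * INR L ^ 2 * cs * V).
Proof.
  intros HL Hrl Ho Hcs HLc Hc Hmod HM V.
  (* Truncated subtraction gives [s 0 = 0], so the initial block is merely shorter. Each later block
     starts where [m + o] is a multiple of [L], that is, with a gap. *)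
  set (s := fun j => (j * L - o)%nat).
  pose proof (mgf_blocks c s (S M) L cs) as H. cbv zeta in H.
  assert (HsM : (M <= s (S M))%nat) by (unfold s; nia).
  rewrite (psum_stable (fun m => Rsqr (c m)) M (s (S M))) in H; auto.
  2:{ intros m Hm. rewrite HM by auto. apply Rsqr_0. }
  rewrite (E_ext (fun x => exp (psum (fun m => c m * cosf (n m) x) M))
                 (fun x => exp (psum (fun m => c m * cosf (n m) x) (s (S M))))).
  2:{ intros x. rewrite (psum_stable (fun m => c m * cosf (n m) x) M (s (S M))); auto.
      intros m Hm. rewrite HM by auto. ring. }
  apply H; auto; unfold s; intros; try nia.
  apply Hmod. replace (m + o)%nat with ((m + o - j * L) + j * L)%nat by nia.
  rewrite Nat.Div0.mod_add, Nat.mod_small; nia.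
Qed.

Lemma psum_mod_shift f L m : (0 < L)%nat ->
  psum (fun o => f ((m + o) mod L)%nat) L = psum f L.
Proof.
  intros HL. induction m as [|m IH].
  - apply psum_ext. intros i Hi. simpl. rewrite Nat.mod_small; auto.
  - rewrite <- IH. destruct L as [|L]; [lia|].
    pose proof (psum_split (fun o => f ((m + o) mod S L)%nat) 1 L) as H.
    change (1 + L)%nat with (S L) in H. rewrite H, psum_S.
    rewrite (psum_ext (fun i => f ((m + (1 + i)) mod S L)%nat) (fun i => f ((S m + i) mod S L)%nat)).
    2:{ intros; do 2 f_equal; lia. }
    change (psum (fun o => f ((m + o) mod S L)%nat) 1) with (0 + f ((m + 0) mod S L)%nat).
    replace ((S m + L) mod S L)%nat with ((m + 0) mod S L)%nat; [lra|].
    replace (S m + L)%nat with (m + 0 + 1 * S L)%nat by lia. rewrite Nat.Div0.mod_add. reflexivity.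
Qed.

Lemma psum_good L : (r <= L)%nat ->
  psum (fun u => if lt_dec u r then 0 else 1) L = INR L - INR r.
Proof.
  intros H.
  assert (HL : psum (fun u => if lt_dec u r then 0 else 1) (r + (L - r)) = INR (L - r)).
  { rewrite psum_split.
    rewrite (psum_ext _ (fun _ => 0) r), (psum_ext _ (fun _ => 1) (L - r)).
    - rewrite !psum_const. lra.
    - intros i _. destruct lt_dec; [lia|auto].
    - intros i Hi. destruct lt_dec; [auto|lia]. }
  replace (r + (L - r))%nat with L in HL by lia. rewrite HL, minus_INR by auto. reflexivity.
Qed.

Lemma jensen_exp (y : nat -> R) L : (0 < L)%nat ->
  exp (/ INR L * psum y L) <= / INR L * psum (fun o => exp (y o)) L.
Proof.
  intros HL. set (t := / INR L * psum y L). pose proof (lt_0_INR L HL) as HL'.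
  (* Tangent line of [exp] at the mean [t]. *)
  apply Rle_trans with (/ INR L * psum (fun o => exp t * (1 - t) + exp t * y o) L).
  - rewrite psum_plus, psum_const, psum_scal.
    replace (psum y L) with (INR L * t) by (unfold t; field; lra).
    right. field. lra.
  - apply Rmult_le_compat_l; [left; apply Rinv_0_lt_compat; auto|].
    apply psum_le. intros o _. pose proof (exp_ineq1_le (y o - t)).
    replace (y o) with (t + (y o - t)) at 2 by ring. rewrite exp_plus.
    pose proof (exp_pos t). nra.
Qed.

(* Each index survives in exactly [L - r] of the [L] offsets, so the full sum is the mean over
   the offsets of the sums with gaps, inflated by [L / (L - r)]. *)
Lemma mgf_upper c L cs M :
  (1 <= L)%nat -> (2 * r <= L)%nat -> 0 <= cs -> 2 * INR L * cs <= / 2 ->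
  (forall m, Rabs (c m) <= cs) -> (forall m, (M <= m)%nat -> c m = 0) ->
  let V := psum (fun m => Rsqr (c m)) M in
  E (fun x => exp (psum (fun m => c m * cosf (n m) x) M))
    <= exp (V / 4 + (2 * INR r / INR L + 16 * INR L ^ 2 * cs) * V).
Proof.
  intros HL Hrl Hcs HLc Hc HM V.
  assert (HL' : 1 <= INR L) by (apply (le_INR 1); auto).
  assert (Hr2 : 2 * INR r <= INR L) by (apply le_INR in Hrl; rewrite mult_INR in Hrl; exact Hrl).
  pose proof (pos_INR r) as Hr0.
  set (k := INR L / (INR L - INR r)).
  assert (Hk1 : k * (INR L - INR r) = INR L) by (unfold k; field; lra).
  assert (Hk2 : 1 <= k <= 2) by nra.
  set (g := fun o m => if lt_dec ((m + o) mod L) r then 0 else 1).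
  set (d := fun o m => k * g o m * c m).
  assert (Hg : forall o m, 0 <= g o m <= 1) by (intros; unfold g; destruct lt_dec; lra).
  assert (Hsum : forall x, psum (fun m => c m * cosf (n m) x) M =
    / INR L * psum (fun o => psum (fun m => d o m * cosf (n m) x) M) L).
  { intros x. rewrite psum_swap, <- psum_scal. apply psum_ext. intros m _.
    rewrite (psum_ext _ (fun o => (k * c m * cosf (n m) x) * g o m)).
    2:{ intros; unfold d; ring. }
    rewrite psum_scal. unfold g.
    rewrite (psum_mod_shift (fun u => if lt_dec u r then 0 else 1)) by lia.
    rewrite psum_good by lia.
    replace (k * c m * cosf (n m) x * (INR L - INR r)) with (k * (INR L - INR r) * c m * cosf (n m) x) by ring.
    rewrite Hk1. field. lra. }
  assert (HVo : forall o, psum (fun m => Rsqr (d o m)) M <= k * k * V).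
  { intros o. unfold V. rewrite <- psum_scal. apply psum_le. intros m _. unfold d, Rsqr.
    specialize (Hg o m). assert (g o m * g o m <= 1) by nra.
    assert (0 <= (k * c m) * (k * c m)) by nra. nra. }
  assert (HV0 : 0 <= V) by (apply psum_ge0; intros; apply Rle_0_sqr).
  set (B := exp (V / 4 + (2 * INR r / INR L + 16 * INR L ^ 2 * cs) * V)).
  assert (Hcd : forall o, continuity (fun x => exp (psum (fun m => d o m * cosf (n m) x) M))).
  { intros o. apply cont_exp, cont_psum. intros. apply cont_mult; [apply cont_const|apply cont_cosf]. }
  assert (HE : forall o, (o < L)%nat ->
    E (fun x => exp (psum (fun m => d o m * cosf (n m) x) M)) <= B).
  { intros o Ho.
    destruct (mgf_offset (d o) L o (k * cs) M) as [_ H]; auto; try lia; try nra.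
    - intros m. unfold d. rewrite !Rabs_mult, (Rabs_pos_eq k), (Rabs_pos_eq (g o m)) by (try apply Hg; lra).
      specialize (Hg o m). specialize (Hc m). pose proof (Rabs_pos (c m)).
      assert (g o m * Rabs (c m) <= cs) by nra. rewrite Rmult_assoc. apply Rmult_le_compat_l; lra.
    - intros m Hm. unfold d, g. destruct lt_dec; [ring|lia].
    - intros m Hm. unfold d. rewrite HM by auto. ring.
    - eapply Rle_trans; [exact H|]. apply exp_le. specialize (HVo o).
      set (Vo := psum (fun m => Rsqr (d o m)) M) in *.
      set (e := INR r / INR L).
      (* With [e = r/L <= 1/2] the inflation [k = 1/(1-e)] satisfies [k^2 <= 1 + 6e], which costs at
         most [2e * V] in [V/4]; [k^3 <= 8] turns the constant 2 of the error into 16. *)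
      assert (He : k <= 1 + 2 * e).
      { unfold k, e. apply Rmult_le_reg_r with (INR L * (INR L - INR r)); [nra|].
        replace (INR L / (INR L - INR r) * (INR L * (INR L - INR r))) with (INR L * INR L) by (field; lra).
        replace ((1 + 2 * (INR r / INR L)) * (INR L * (INR L - INR r)))
          with ((INR L + 2 * INR r) * (INR L - INR r)) by (field; lra).
        nra. }
      assert (He2 : 0 <= e <= / 2).
      { unfold e. split; [apply Rdiv_le_0_compat; lra|].
        apply Rmult_le_reg_r with (INR L); [lra|]. unfold Rdiv. rewrite Rmult_assoc, Rinv_l; lra. }
      replace (2 * INR r / INR L) with (2 * e) by (unfold e; field; lra).
      assert (Hkk : k * k <= 1 + 6 * e) by nra.
      assert (HA : 0 <= INR L ^ 2 * cs) by (apply Rmult_le_pos; [apply pow_le|]; lra).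
      set (A := INR L ^ 2 * cs) in *.
      replace (2 * INR L ^ 2 * (k * cs)) with (2 * k * A) by (unfold A; ring).
      replace (16 * INR L ^ 2 * cs) with (16 * A) by (unfold A; ring).
      assert (Vo / 4 <= V / 4 + 2 * e * V) by nra.
      assert (k * k * k <= 8) by nra.
      assert (2 * k * A * Vo <= 2 * k * A * (k * k * V)) by (apply Rmult_le_compat_l; nra).
      assert (2 * k * A * (k * k * V) <= 16 * A * V); [|lra].
      replace (2 * k * A * (k * k * V)) with ((k * k * k) * (2 * A * V)) by ring.
      assert (0 <= A * V) by nra. nra. }
  apply Rle_trans with
    (E (fun x => / INR L * psum (fun o => exp (psum (fun m => d o m * cosf (n m) x) M)) L)).
  - apply E_le.
    + apply cont_exp, cont_psum. intros. apply cont_mult; [apply cont_const|apply cont_cosf].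
    + apply cont_mult; [apply cont_const|]. apply cont_psum; auto.
    + intros x. rewrite Hsum. apply jensen_exp. lia.
  - rewrite E_scal, E_psum by (try apply cont_psum; auto).
    apply Rle_trans with (/ INR L * (INR L * B)); [|right; field; lra].
    apply Rmult_le_compat_l; [left; apply Rinv_0_lt_compat; lra|].
    rewrite <- psum_const. apply psum_le. auto.
Qed.

Context (sigma : nat -> nat) (Hsigma : forall i j, sigma i = sigma j -> i = j).

Definition lsum (a : nat -> R) (N : nat) (x : R) : R :=
  psum (fun i => a i * cosf (n (sigma i)) x) N.

Lemma cont_lsum a N : continuity (lsum a N).
Proof. apply cont_psum. intros. apply cont_mult; [apply cont_const|apply cont_cosf]. Qed.

Lemma push_bound a N cs : 0 <= cs -> (forall i, (i < N)%nat -> Rabs (a i) <= cs) ->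
  forall m, Rabs (push sigma a N m) <= cs.
Proof.
  intros Hcs Ha m. destruct (push_cases sigma a N m Hsigma) as [->|(i & Hi & _ & ->)]; auto.
  rewrite Rabs_R0. auto.
Qed.

Lemma mgf_perm_upper a N L cs :
  (1 <= L)%nat -> (2 * r <= L)%nat -> 0 <= cs -> 2 * INR L * cs <= / 2 ->
  (forall i, (i < N)%nat -> Rabs (a i) <= cs) ->
  let V := psum (fun i => Rsqr (a i)) N in
  E (fun x => exp (lsum a N x))
    <= exp (V / 4 + (2 * INR r / INR L + 16 * INR L ^ 2 * cs) * V).
Proof.
  intros HL Hrl Hcs HLc Ha V. destruct (nat_bound sigma N) as [M HM].
  pose proof (mgf_upper (push sigma a N) L cs M HL Hrl Hcs HLc) as H. cbv zeta in H.
  rewrite (push_sq sigma a N M Hsigma HM) in H.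
  rewrite (E_ext _ (fun x => exp (psum (fun m => push sigma a N m * cosf (n m) x) M))).
  - apply H; [apply push_bound; auto|]. intros m Hm. apply push_out.
    intros i Hi <-. specialize (HM i Hi). lia.
  - intros x. f_equal. unfold lsum. symmetry. apply push_spec; auto.
Qed.

(** Vanishing on the gaps is a condition on the position [sigma i] of a frequency, not on its rank
    [i] in the permuted sum. *)
Lemma mgf_perm_lower a N L o cs :
  (1 <= L)%nat -> (r <= L)%nat -> (o < L)%nat -> 0 <= cs -> INR L * cs <= / 2 ->
  (forall i, (i < N)%nat -> Rabs (a i) <= cs) ->
  (forall i, (i < N)%nat -> ((sigma i + o) mod L < r)%nat -> a i = 0) ->
  let V := psum (fun i => Rsqr (a i)) N in
  exp (V / 4 - 2 * INR L ^ 2 * cs * V) <= E (fun x => exp (lsum a N x)).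
Proof.
  intros HL Hrl Ho Hcs HLc Ha Hz V. destruct (nat_bound sigma N) as [M HM].
  pose proof (mgf_offset (push sigma a N) L o cs M HL Hrl Ho Hcs HLc) as H. cbv zeta in H.
  rewrite (push_sq sigma a N M Hsigma HM) in H.
  rewrite (E_ext (fun x => exp (lsum a N x))
    (fun x => exp (psum (fun m => push sigma a N m * cosf (n m) x) M))).
  - apply H; [apply push_bound; auto| |].
    + intros m Hm. destruct (push_cases sigma a N m Hsigma) as [->|(i & Hi & <- & ->)]; auto.
    + intros m Hm. apply push_out. intros i Hi <-. specialize (HM i Hi). lia.
  - intros x. f_equal. unfold lsum. symmetry. apply push_spec; auto.
Qed.

End MGF.

(** * The upper bound *)

Lemma ln_le_sub1 y : 0 < y -> ln y <= y - 1.
Proof. intros Hy. pose proof (exp_ineq1_le (ln y)). rewrite exp_ln in H; lra. Qed.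

Lemma exp_le_inv a b : exp a <= exp b -> a <= b.
Proof. intros H. apply Rnot_lt_le. intros h. apply exp_increasing in h. lra. Qed.

Lemma INR_ge_one a : (1 <= a)%nat -> 1 <= INR a.
Proof. exact (le_INR 1 a). Qed.

Lemma INR_ge_three a : (3 <= a)%nat -> 3 <= INR a.
Proof. intros H. apply le_INR in H. simpl in H. lra. Qed.

Lemma exp_ln_sq y : 0 < y -> exp (2 * ln y) = y * y.
Proof. intros. replace (2 * ln y) with (ln y + ln y) by ring. rewrite exp_plus, exp_ln; auto. Qed.

Lemma ln_ge_one y : 3 <= y -> 1 <= ln y.
Proof.
  intros Hy. apply exp_le_inv. rewrite exp_ln by lra. pose proof exp_le_3. lra.
Qed.

Lemma exp_nat a : exp (INR a) <= 3 ^ a.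
Proof.
  induction a as [|a IH]; [simpl; rewrite exp_0; lra|].
  rewrite S_INR, exp_plus. simpl. pose proof exp_le_3. pose proof (exp_pos (INR a)).
  pose proof (exp_pos 1). nra.
Qed.

Lemma pow3_dominates C : exists a0, forall a, (a0 <= a)%nat -> C * (INR a * INR a) <= 3 ^ a.
Proof.
  (* [3^a >= e^a >= (a/3)^3 = a^3/27]. *)
  destruct (INR_unbounded (27 * C)) as [a0 Ha0]. exists a0. intros a Ha. apply le_INR in Ha.
  eapply Rle_trans; [|apply exp_nat].
  replace (INR a) with (INR a / 3 + INR a / 3 + INR a / 3) at 3 by field.
  rewrite !exp_plus. pose proof (exp_ineq1_le (INR a / 3)). pose proof (pos_INR a).
  assert (INR a / 3 * (INR a / 3) <= exp (INR a / 3) * exp (INR a / 3)) by nra.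
  assert (INR a / 3 * (INR a / 3) * (INR a / 3) <=
     exp (INR a / 3) * exp (INR a / 3) * exp (INR a / 3)).
  { apply Rmult_le_compat; nra. }
  nra.
Qed.

Lemma ex_series_telescope w : (forall k, 0 <= w k) -> (forall k, w (S k) <= w k) ->
  ex_series (fun k => w k - w (S k)).
Proof.
  intros H0 Hd.
  destruct (ex_finite_lim_seq_decr w 0 Hd H0) as [l Hl].
  exists (w 0%nat - l).
  change (is_lim_seq (sum_n (fun k => w k - w (S k))) (w 0%nat - l)).
  apply (is_lim_seq_ext (fun N => w 0%nat - w (S N))).
  - intros N. induction N as [|N IH].
    + rewrite sum_O. reflexivity.
    + rewrite sum_Sn, <- IH. unfold plus; simpl. lra.
  - apply is_lim_seq_minus'; [apply is_lim_seq_const|]. apply (is_lim_seq_incr_1 w). exact Hl.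
Qed.

(** The terms [k^(-1-e)] are dominated by the decrements of [k^(-e) / e], which telescope. Two terms
    are dropped so that all logarithms are taken at positive integers. *)
Lemma ex_series_ln_pow e : 0 < e -> ex_series (fun k => exp (- (1 + e) * ln (INR k))).
Proof.
  intros He. apply (ex_series_incr_n _ 2).
  set (w := fun k => exp (- e * ln (INR (S k)))).
  assert (Hw : forall k, exp (- (1 + e) * ln (INR (2 + k))) <= / e * (w k - w (S k))).
  { intros k. unfold w. set (y := INR (S (S k))). change (INR (2 + k)) with y.
    assert (Hy : y = INR (S k) + 1) by apply S_INR.
    assert (Hk : 0 < INR (S k)) by (apply lt_0_INR; lia).
    assert (Hl : / y <= ln y - ln (INR (S k))).
    { pose proof (ln_le_sub1 (INR (S k) / y) ltac:(apply Rdiv_lt_0_compat; lra)) as H.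
      rewrite ln_div in H by lra.
      replace (INR (S k) / y) with (1 - / y) in H by (rewrite Hy; field; lra). lra. }
    replace (- e * ln (INR (S k))) with (- e * ln y + e * (ln y - ln (INR (S k)))) by ring.
    rewrite exp_plus.
    replace (- (1 + e) * ln y) with (- ln y + - e * ln y) by ring.
    rewrite exp_plus, exp_Ropp, exp_ln by lra.
    pose proof (exp_pos (- e * ln y)) as Hp. set (W := exp (- e * ln y)) in *.
    pose proof (exp_ineq1_le (e * (ln y - ln (INR (S k))))) as H1.
    apply Rmult_le_reg_l with e; auto. rewrite <- Rmult_assoc, <- (Rmult_assoc e (/ e)), Rinv_r by lra.
    assert (e * / y <= e * (ln y - ln (INR (S k)))) by (apply Rmult_le_compat_l; lra).
    nra. }
  apply (ex_series_le (V := R_CompleteNormedModule) _ (fun k => / e * (w k - w (S k)))).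
  - intros k. unfold norm; simpl. unfold abs; simpl. rewrite Rabs_pos_eq; [apply Hw|].
    left; apply exp_pos.
  - apply (ex_series_scal (V := R_NormedModule) (/ e) (fun k => w k - w (S k))). apply ex_series_telescope.
    + intros; left; apply exp_pos.
    + intros k. apply exp_le.
      assert (ln (INR (S k)) <= ln (INR (S (S k)))); [|nra].
      apply ln_le; [apply lt_0_INR; lia|apply le_INR; lia].
Qed.

Lemma psum_pos_lt1 f N : (forall i, (i < N)%nat -> 0 <= f i) -> psum f N < 1 ->
  forall i, (i < N)%nat -> f i < 1.
Proof. intros H H1 i Hi. pose proof (psum_term f N i H Hi). lra. Qed.

Lemma exp_lt1_inv y : exp y < 1 -> y < 0.
Proof. intros H. apply exp_lt_inv. rewrite exp_0. exact H. Qed.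

Section Upper.
Context (n : nat -> nat) (q : R) (Hgap : hadamard_gap n q).
Context (sigma : nat -> nat) (Hsigma : forall i j, sigma i = sigma j -> i = j).

Lemma gap_exponent : exists r, 3 + 3 / (q - 1) < q ^ r.
Proof.
  destruct Hgap as (Hq & _ & _).
  destruct (Pow_x_infinity q ltac:(rewrite Rabs_pos_eq; lra) (3 + 3 / (q - 1) + 1)) as [r Hr].
  exists r. specialize (Hr r (le_n _)). rewrite Rabs_pos_eq in Hr; [lra|apply pow_le; lra].
Qed.

(** The block length [L] is fixed first, to make the gap loss [2r/L] small; only then is the
    coefficient bound [l0] chosen, small relative to [L^2]. *)
Lemma mgf_small e : 0 < e -> exists l0, 0 < l0 /\ forall a N cs,
  0 <= cs <= l0 -> (forall i, (i < N)%nat -> Rabs (a i) <= cs) ->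
  E (fun x => exp (lsum n sigma a N x)) <= exp ((/ 4 + e) * psum (fun i => Rsqr (a i)) N).
Proof.
  intros He. destruct gap_exponent as [r Hr].
  destruct (INR_unbounded (4 * INR r / e)) as [L0 HL0].
  set (L := S (L0 + 2 * r)).
  assert (HL : 1 <= INR L) by (apply INR_ge_one; unfold L; lia).
  assert (HrL : 2 * INR r / INR L <= e / 2).
  { assert (INR L0 <= INR L) by (apply le_INR; unfold L; lia).
    apply Rmult_le_reg_r with (INR L); [lra|]. unfold Rdiv at 1. rewrite Rmult_assoc, Rinv_l by lra.
    pose proof (pos_INR r).
    assert (4 * INR r / e * e = 4 * INR r) by (field; lra). nra. }
  exists (Rmin (/ (4 * INR L)) (e / (32 * INR L ^ 2))).
  pose proof (pow_R1_Rle (INR L) 2 HL) as HL2.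
  split.
  { apply Rmin_pos; [apply Rinv_0_lt_compat; lra|apply Rdiv_lt_0_compat; lra]. }
  intros a N cs [Hcs Hcs'] Ha.
  assert (H1 : cs <= / (4 * INR L)) by (eapply Rle_trans; [exact Hcs'|apply Rmin_l]).
  assert (H2 : cs <= e / (32 * INR L ^ 2)) by (eapply Rle_trans; [exact Hcs'|apply Rmin_r]).
  assert (H1' : INR L * cs <= / 4).
  { apply Rle_trans with (INR L * / (4 * INR L)); [nra|right; field; lra]. }
  assert (H2' : 16 * INR L ^ 2 * cs <= e / 2).
  { apply Rle_trans with (16 * INR L ^ 2 * (e / (32 * INR L ^ 2))); [nra|right; field; lra]. }
  eapply Rle_trans.
  - apply (mgf_perm_upper n q Hgap r Hr sigma Hsigma a N L cs); auto; try (unfold L; lia); lra.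
  - apply exp_le.
    assert (0 <= psum (fun i => Rsqr (a i)) N) by (apply psum_ge0; intros; apply Rle_0_sqr).
    nra.
Qed.

Definition perm_sum (N : nat) (x : R) : R := psum (fun i => cosf (n (sigma i)) x) N.

Definition indic (A B i : nat) : R := if le_dec A i then if lt_dec i B then 1 else 0 else 0.

Lemma cont_perm_sum N : continuity (perm_sum N).
Proof. apply cont_psum. intros. apply cont_cosf. Qed.

Lemma psum_indic f A B N : (A <= B <= N)%nat ->
  psum (fun i => indic A B i * f i) N = psum f B - psum f A.
Proof.
  intros H. set (g := fun i => indic A B i * f i).
  assert (H1 : psum g A = 0).
  { rewrite (psum_ext _ (fun _ => 0)); [rewrite psum_const; lra|].
    intros i Hi. unfold g, indic. destruct le_dec; [lia|ring]. }
  assert (H2 : psum (fun i => g (A + i)%nat) (B - A) = psum (fun i => f (A + i)%nat) (B - A)).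
  { apply psum_ext. intros i Hi. unfold g, indic.
    destruct le_dec; [destruct lt_dec; [ring|lia]|lia]. }
  assert (H3 : psum (fun i => g (B + i)%nat) (N - B) = 0).
  { rewrite (psum_ext _ (fun _ => 0)); [rewrite psum_const; lra|].
    intros i _. unfold g, indic. destruct le_dec; [destruct lt_dec; [lia|ring]|ring]. }
  pose proof (psum_split g B (N - B)) as E1. replace (B + (N - B))%nat with N in E1 by lia.
  pose proof (psum_split g A (B - A)) as E2. replace (A + (B - A))%nat with B in E2 by lia.
  pose proof (psum_split f A (B - A)) as E3. replace (A + (B - A))%nat with B in E3 by lia.
  lra.
Qed.

Lemma indic_01 A B i : indic A B i = 0 \/ indic A B i = 1.
Proof. unfold indic. destruct le_dec; [destruct lt_dec|]; auto. Qed.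

Lemma mgf_interval e : 0 < e -> exists l0, 0 < l0 /\ forall t A B,
  Rabs t <= l0 -> (A <= B)%nat ->
  E (fun x => exp (t * (perm_sum B x - perm_sum A x))) <= exp ((/ 4 + e) * (t * t * (INR B - INR A))).
Proof.
  intros He. destruct (mgf_small e He) as (l0 & Hl0 & H). exists l0. split; auto.
  intros t A B Ht HAB.
  specialize (H (fun i => t * indic A B i) B (Rabs t)). cbv beta in H.
  replace (psum (fun i => Rsqr (t * indic A B i)) B) with (t * t * (INR B - INR A)) in H.
  - rewrite (E_ext _ (fun x => exp (lsum n sigma (fun i => t * indic A B i) B x))).
    + apply H; [split; auto; apply Rabs_pos|]. intros i _. rewrite Rabs_mult.
      pose proof (Rabs_pos t). destruct (indic_01 A B i) as [-> | ->]; rewrite ?Rabs_R0, ?Rabs_R1; lra.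
    + intros x. f_equal. unfold lsum, perm_sum.
      rewrite <- (psum_indic _ A B B) by lia. rewrite <- psum_scal.
      apply psum_ext; intros; ring.
  - rewrite (psum_ext _ (fun i => t * t * (indic A B i * 1))).
    + rewrite psum_scal, psum_indic by lia. rewrite !psum_const. ring.
    + intros i _. unfold Rsqr. destruct (indic_01 A B i) as [-> | ->]; ring.
Qed.

(** Continuous majorant, as in the exponential Markov inequality, of the indicator that a signed
    increment reaches [th]. *)
Definition tail (t th : R) (sg : R) (A B : nat) (x : R) : R :=
  exp (t * (sg * (perm_sum B x - perm_sum A x) - th)).

Lemma cont_tail t th sg A B : continuity (tail t th sg A B).
Proof. unfold tail. cont; apply cont_perm_sum. Qed.

Lemma E_tail e l0 : (forall t A B, Rabs t <= l0 -> (A <= B)%nat ->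
    E (fun x => exp (t * (perm_sum B x - perm_sum A x))) <= exp ((/ 4 + e) * (t * t * (INR B - INR A)))) ->
  forall t th sg A B c, sg * sg = 1 -> 0 <= t <= l0 -> (A <= B)%nat ->
  (/ 4 + e) * (t * t * (INR B - INR A)) - t * th <= c -> E (tail t th sg A B) <= exp c.
Proof.
  intros H t th sg A B c Hsg Ht HAB Hc.
  rewrite (E_ext _ (fun x => exp (- (t * th)) * exp ((t * sg) * (perm_sum B x - perm_sum A x)))).
  - rewrite E_scal by (cont; apply cont_perm_sum).
    eapply Rle_trans.
    + apply Rmult_le_compat_l; [left; apply exp_pos|]. apply H; auto.
      rewrite Rabs_mult, (Rabs_pos_eq t) by lra.
      assert (Rabs sg * Rabs sg = 1) by (rewrite <- Rabs_mult, Hsg; apply Rabs_R1).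
      pose proof (Rabs_pos sg). nra.
    + rewrite <- exp_plus. apply exp_le.
      replace (t * sg * (t * sg)) with (t * t * (sg * sg)) by ring. rewrite Hsg. lra.
  - intros x. unfold tail. rewrite <- exp_plus. f_equal. ring.
Qed.

Lemma tail_lt1 t th sg A B x : 0 < t -> tail t th sg A B x < 1 ->
  sg * (perm_sum B x - perm_sum A x) < th.
Proof. intros Ht H. apply exp_lt1_inv in H. nra. Qed.

Lemma sqrt_sub_mult u v : 0 <= u -> 0 < v -> sqrt (u / v) * sqrt (v * u) = u.
Proof.
  intros Hu Hv. rewrite <- sqrt_mult.
  - replace (u / v * (v * u)) with (u * u) by (field; lra). apply sqrt_square; auto.
  - apply Rdiv_le_0_compat; lra.
  - nra.
Qed.

(** * Three-scale chaining for the upper bound *)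

Context (eta : R) (Heta : 0 < eta <= 1) (m : nat) (Hm : 9 <= eta * eta * INR m).

Definition base (a b : nat) : nat := (3 ^ a * (m + b))%nat.
Definition grid (a b i : nat) : nat := (base a b + (i * 3 ^ a) / (a * a))%nat.

(** Indices of generation [a] lie between [3^a * m] and [3^(a+1) * m], so [ln a] stands in for log
    log N. Increments inside a cell have length at most [3^a], a fraction [1/m] of N; this is why
    [th1] can afford the small factor [eta]. *)
Definition th0 (a b : nat) : R := (1 + eta) * sqrt (INR (base a b) * ln (INR a)).
Definition th1 (a : nat) : R := eta * sqrt (3 ^ a * INR m * ln (INR a)).

(** The parameters of [lev0] and [lev1] are Gaussian choices of order sqrt(ln a / length). That of
    [lev2] is larger: it must beat a union over [3^a] indices, and the fine mesh keeps its variance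
    cost bounded. *)
Definition lev0 sg a b : R -> R :=
  tail (2 * sqrt (ln (INR a) / INR (base a b))) (th0 a b) sg 0 (base a b).
Definition lev1 sg a b i : R -> R :=
  tail (2 * sqrt (ln (INR a) / 3 ^ a)) (th1 a) sg (base a b) (grid a b i).
Definition lev2 sg a b j : R -> R :=
  tail (INR a / sqrt (3 ^ a)) (th1 a) sg (grid a b (j * (a * a) / 3 ^ a)) (base a b + j).

(* Three scales of the chaining: geometrically spaced indices, increments to a grid of mesh
   [3^a / a^2], and increments from the grid to every index. *)
Definition level (sg : R) (a : nat) (x : R) : R :=
  psum (fun b => lev0 sg a b x + psum (fun i => lev1 sg a b i x) (a * a)
                 + psum (fun j => lev2 sg a b j x) (3 ^ a)) (2 * m).

Lemma m_pos : (1 <= m)%nat.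
Proof. destruct m; [simpl in Hm; lra|lia]. Qed.

Lemma INR_pow3 a : INR (3 ^ a) = 3 ^ a.
Proof. rewrite pow_INR. f_equal. simpl. ring. Qed.

Lemma INR_base a b : INR (base a b) = 3 ^ a * (INR m + INR b).
Proof. unfold base. rewrite mult_INR, plus_INR, INR_pow3. reflexivity. Qed.

Lemma sqrt_m : 3 <= eta * sqrt (INR m).
Proof.
  apply Rsqr_incr_0; try lra.
  - unfold Rsqr. pose proof (sqrt_sqrt (INR m) (pos_INR m)). nra.
  - apply Rmult_le_pos; [lra|apply sqrt_pos].
Qed.

Lemma level_bound sg : sg * sg = 1 -> exists a0, forall a, (a0 <= a)%nat ->
  E (level sg a) <=
    INR (2 * m) * (exp (- (1 + eta) * ln (INR a)) + exp (- (1 + eta) * ln (INR a)) + 3 * (3 / 8) ^ a).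
Proof.
  intros Hsg. destruct (mgf_interval (eta / 4) ltac:(lra)) as (l0 & Hl0 & Hmgf).
  pose proof (E_tail _ _ Hmgf) as HT.
  (* The summand [4 / l0^2] brings twice [a / sqrt (3^a)], hence all three parameters, below [l0];
     the summand 1 gives [a^2 <= 3^a]. *)
  destruct (pow3_dominates (4 / (l0 * l0) + 1)) as [a0 Ha0].
  exists (Nat.max 3 a0). intros a Ha. specialize (Ha0 a ltac:(lia)).
  assert (Ha3 : 3 <= INR a) by (apply INR_ge_three; lia).
  set (y := INR a) in *. set (P := 3 ^ a) in *.
  assert (HP : 0 < P) by (apply pow_lt; lra).
  assert (Hl4 : 0 < 4 / (l0 * l0)) by (apply Rdiv_lt_0_compat; nra).
  assert (HP1 : y * y <= P) by nra.
  pose proof (ln_ge_one y Ha3) as Hln.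
  pose proof (ln_le_sub1 y ltac:(lra)) as Hlny.
  pose proof sqrt_m as Hsm.
  assert (Hm1 : 1 <= INR m) by apply INR_ge_one, m_pos.
  assert (HsP : 0 < sqrt P) by (apply sqrt_lt_R0; auto).
  assert (Ht2 : 2 * (y / sqrt P) <= l0).
  { apply Rsqr_incr_0; [| |lra].
    - unfold Rsqr.
      replace (2 * (y / sqrt P) * (2 * (y / sqrt P))) with (4 * (y * y) / (sqrt P * sqrt P)) by (field; lra).
      rewrite sqrt_sqrt by lra. apply Rmult_le_reg_r with P; auto.
      unfold Rdiv. rewrite Rmult_assoc, Rinv_l by lra. rewrite Rmult_1_r.
      apply Rle_trans with ((l0 * l0) * ((4 / (l0 * l0) + 1) * (y * y))); [|apply Rmult_le_compat_l; nra].
      replace ((l0 * l0) * ((4 / (l0 * l0) + 1) * (y * y))) with (4 * (y * y) + (l0 * l0) * (y * y)) by (field; lra).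
      nra.
    - assert (0 < y / sqrt P) by (apply Rdiv_lt_0_compat; lra). lra. }
  assert (Ht20 : 0 < y / sqrt P) by (apply Rdiv_lt_0_compat; lra).
  assert (Ht1 : sqrt (ln y / P) <= y / sqrt P).
  { rewrite sqrt_div by lra. apply Rmult_le_compat_r; [left; apply Rinv_0_lt_compat; auto|].
    apply Rsqr_incr_0; [|apply sqrt_pos|lra]. rewrite Rsqr_sqrt by lra. unfold Rsqr. nra. }
  assert (Hcont : forall b, continuity (fun x => lev0 sg a b x + psum (fun i => lev1 sg a b i x) (a * a)
                 + psum (fun j => lev2 sg a b j x) (3 ^ a))).
  { intros b. cont; apply cont_tail. }
  unfold level. rewrite E_psum by auto.
  rewrite <- psum_const. apply psum_le. intros b Hb.
  rewrite !E_plus, !E_psum by first [(intros ? _; apply cont_tail) | (cont; apply cont_tail)].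
  pose proof (INR_base a b) as Hbase. fold P in Hbase. pose proof (pos_INR b) as Hb0.
  assert (HbP : P <= INR (base a b)) by nra.
  set (p := INR (base a b)) in *.
  assert (Hth1 : th1 a = eta * sqrt (INR m) * sqrt (P * ln y)).
  { unfold th1. fold P y. replace (P * INR m * ln y) with (INR m * (P * ln y)) by ring.
    rewrite sqrt_mult by nra. ring. }
  assert (Hi : forall u v w w', u <= w -> v <= w' -> u + v <= w + w') by (intros; lra).
  repeat apply Hi.
  (* With [t^2 * p = 4 ln a] the exponent is [(1 + eta) ln a - 2 (1 + eta) ln a]. *)
  - apply HT; auto; try lia.
    + fold y p. split; [pose proof (sqrt_pos (ln y / p)); lra|].
      apply Rle_trans with (2 * (y / sqrt P)); auto. apply Rmult_le_compat_l; [lra|].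
      eapply Rle_trans; [|exact Ht1]. apply sqrt_le_1_alt. unfold Rdiv.
      apply Rmult_le_compat_l; [lra|]. apply Rinv_le_contravar; lra.
    + fold y p. unfold th0. fold y p. simpl INR. rewrite Rminus_0_r.
      set (u := sqrt (ln y / p)).
      assert (Huu : u * u * p = ln y).
      { unfold u. rewrite sqrt_sqrt by (apply Rdiv_le_0_compat; lra). field. lra. }
      replace ((/ 4 + eta / 4) * (2 * u * (2 * u) * p)) with ((1 + eta) * (u * u * p)) by field.
      replace (2 * u * ((1 + eta) * sqrt (p * ln y))) with (2 * (1 + eta) * (u * sqrt (p * ln y))) by ring.
      unfold u at 3. rewrite sqrt_sub_mult by lra. rewrite Huu. lra.
  (* The variance costs at most [2 ln a] and the threshold gains at least [6 ln a], because
     [eta * sqrt m >= 3]. The [a^2] grid points still leave [a^(-2)]. *)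
  - apply Rle_trans with (psum (fun _ => exp (- 4 * ln y)) (a * a)).
    + apply psum_le. intros i Hi'.
      assert (HG : (grid a b i <= base a b + 3 ^ a)%nat).
      { unfold grid. apply Nat.add_le_mono_l. apply Nat.Div0.div_le_upper_bound. nia. }
      apply HT; auto.
      * fold y P. split; [pose proof (sqrt_pos (ln y / P)); lra|]. lra.
      * unfold grid; lia.
      * fold y P. rewrite Hth1. apply le_INR in HG. rewrite plus_INR, INR_pow3 in HG.
        fold p P in HG. fold p.
        set (u := sqrt (ln y / P)). assert (Hu0 : 0 <= u) by apply sqrt_pos.
        assert (Huu : u * u * P = ln y).
        { unfold u. rewrite sqrt_sqrt by (apply Rdiv_le_0_compat; lra). field. lra. }
        replace (2 * u * (eta * sqrt (INR m) * sqrt (P * ln y)))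
          with (2 * (eta * sqrt (INR m)) * (u * sqrt (P * ln y))) by ring.
        unfold u at 3. rewrite sqrt_sub_mult by lra.
        assert (u * u * (INR (grid a b i) - p) <= ln y).
        { rewrite <- Huu. apply Rmult_le_compat_l; nra. }
        replace (2 * u * (2 * u) * (INR (grid a b i) - p))
          with (4 * (u * u * (INR (grid a b i) - p))) by ring.
        assert (0 <= u * u * (INR (grid a b i) - p)).
        { apply Rmult_le_pos; [nra|]. unfold grid. rewrite plus_INR. fold p.
          pose proof (pos_INR (i * 3 ^ a / (a * a))). lra. }
        nra.
    + rewrite psum_const, mult_INR. fold y. rewrite <- exp_ln_sq, <- exp_plus by lra.
      apply exp_le. nra.
  (* The variance costs at most 1 and the threshold gains at least [3a]; over [3^a] indices the sum
     is at most [3 * (3/8)^a], as [e <= 3] and [e^3 >= 8]. *)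
  - apply Rle_trans with (psum (fun _ => exp (1 - 3 * y)) (3 ^ a)).
    + apply psum_le. intros j Hj.
      set (i := (j * (a * a) / 3 ^ a)%nat).
      assert (HP0 : (3 ^ a <> 0)%nat) by (apply Nat.pow_nonzero; lia).
      assert (Haa : (a * a <> 0)%nat) by nia.
      assert (Hgi : (grid a b i <= base a b + j)%nat).
      { unfold grid. apply Nat.add_le_mono_l. apply Nat.Div0.div_le_upper_bound.
        rewrite (Nat.mul_comm (a * a) j). unfold i. rewrite Nat.mul_comm. apply Nat.Div0.mul_div_le. }
      (* Rounding twice, in [i] and in the grid point, loses at most [3^a / a^2 + 1] indices;
         [a^2 <= 3^a] absorbs the 1. *)
      assert (Hmesh : (INR (base a b + j) - INR (grid a b i)) * (y * y) <= 2 * P).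
      { assert (Hn : ((base a b + j - grid a b i) * (a * a) <= 3 ^ a + a * a)%nat).
        { unfold grid.
          pose proof (Nat.div_mod (j * (a * a)) (3 ^ a) HP0) as D1. fold i in D1.
          pose proof (Nat.mod_upper_bound (j * (a * a)) (3 ^ a) HP0) as D1'.
          pose proof (Nat.div_mod (i * 3 ^ a) (a * a) Haa) as D2.
          pose proof (Nat.mod_upper_bound (i * 3 ^ a) (a * a) Haa) as D2'.
          set (k := (i * 3 ^ a / (a * a))%nat) in *.
          set (A := (a * a)%nat) in *. set (Q := (3 ^ a)%nat) in *.
          replace (base a b + j - (base a b + k))%nat with (j - k)%nat by lia.
          rewrite Nat.mul_sub_distr_r. nia. }
        apply le_INR in Hn. rewrite mult_INR, plus_INR, mult_INR, INR_pow3, minus_INR in Hn by auto.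
        fold y P in Hn. lra. }
      apply HT; auto.
      * fold y P. lra.
      * fold y P i. rewrite Hth1.
        set (t := y / sqrt P) in *.
        set (D := INR (base a b + j) - INR (grid a b i)) in *.
        assert (HD0 : 0 <= D) by (unfold D; apply le_INR in Hgi; lra).
        assert (Htt : t * t * P = y * y).
        { unfold t. replace (y / sqrt P * (y / sqrt P) * P) with (y * y * (P / (sqrt P * sqrt P))) by (field; lra).
          rewrite sqrt_sqrt by lra. field. lra. }
        assert (t * t * D <= 2).
        { apply Rmult_le_reg_r with P; auto. replace (t * t * D * P) with (t * t * P * D) by ring.
          rewrite Htt. lra. }
        assert (0 <= t * t * D) by (apply Rmult_le_pos; nra).
        rewrite sqrt_mult by lra.
        replace (t * (eta * sqrt (INR m) * (sqrt P * sqrt (ln y))))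
          with ((eta * sqrt (INR m)) * (y * sqrt (ln y))) by (unfold t; field; lra).
        assert (1 <= sqrt (ln y)) by (rewrite <- sqrt_1; apply sqrt_le_1_alt; auto).
        assert (y <= y * sqrt (ln y)) by nra.
        assert (3 * y <= eta * sqrt (INR m) * (y * sqrt (ln y))) by (apply Rmult_le_compat; lra).
        nra.
    + rewrite psum_const, INR_pow3. fold P.
      replace (1 - 3 * y) with (1 + - (3 * y)) by ring. rewrite exp_plus, exp_Ropp.
      replace (3 / 8) with (3 * / 8) by lra. rewrite Rpow_mult_distr. fold P.
      rewrite pow_inv.
      assert (H8 : 8 ^ a <= exp (3 * y)).
      { unfold y. clear. induction a as [|a IH]; [simpl; rewrite Rmult_0_r, exp_0; lra|].
        rewrite S_INR. replace (3 * (INR a + 1)) with (3 * INR a + (1 + 1 + 1)) by ring.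
        rewrite !exp_plus. simpl. pose proof (exp_ineq1_le 1).
        pose proof (pow_lt 8 a ltac:(lra)).
        assert (4 <= exp 1 * exp 1) by nra. assert (8 <= exp 1 * exp 1 * exp 1) by nra. nra. }
      pose proof exp_le_3. pose proof (pow_lt 8 a ltac:(lra)) as H8'.
      assert (/ exp (3 * y) <= / 8 ^ a) by (apply Rinv_le_contravar; auto).
      assert (0 < / exp (3 * y)) by (apply Rinv_0_lt_compat, exp_pos).
      pose proof (exp_pos 1).
      assert (exp 1 * / exp (3 * y) <= 3 * / 8 ^ a) by nra. nra.
Qed.

Lemma level_ge0 sg a x : 0 <= level sg a x.
Proof.
  apply psum_ge0. intros b _.
  assert (forall t th A B, 0 <= tail t th sg A B x) by (intros; left; apply exp_pos).
  pose proof (psum_ge0 (fun i => lev1 sg a b i x) (a * a) (fun i _ => H _ _ _ _)).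
  pose proof (psum_ge0 (fun j => lev2 sg a b j x) (3 ^ a) (fun i _ => H _ _ _ _)).
  specialize (H (2 * sqrt (ln (INR a) / INR (base a b))) (th0 a b) 0%nat (base a b)).
  unfold lev0. lra.
Qed.

(** One threshold per scale adds up to [(1 + eta) + eta + eta], and [ln a <= ln (ln N)] because
    [e^a <= 3^a <= N]. *)
Lemma level_lt1 sg a x N : (3 <= a)%nat -> (3 ^ a * m <= N < 3 ^ S a * m)%nat ->
  level sg a x < 1 -> sg * perm_sum N x <= (1 + 3 * eta) * sqrt (INR N * ln (ln (INR N))).
Proof.
  intros Ha HN Hlev.
  assert (HP0 : (3 ^ a <> 0)%nat) by (apply Nat.pow_nonzero; lia).
  pose proof (Nat.div_mod N (3 ^ a) HP0) as Hdm.
  pose proof (Nat.mod_upper_bound N (3 ^ a) HP0) as Hmod.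
  set (j := (N mod 3 ^ a)%nat) in *.
  assert (Hb : (m <= N / 3 ^ a < 3 * m)%nat).
  { split; [apply Nat.div_le_lower_bound; lia|apply Nat.Div0.div_lt_upper_bound; simpl in HN; lia]. }
  set (b := (N / 3 ^ a - m)%nat).
  assert (HNb : N = (base a b + j)%nat) by (unfold base, b; rewrite Hdm at 1; nia).
  set (i := (j * (a * a) / 3 ^ a)%nat).
  assert (Hi : (i < a * a)%nat) by (apply Nat.Div0.div_lt_upper_bound; nia).
  assert (Hpos : forall t th A B, 0 <= tail t th sg A B x) by (intros; left; apply exp_pos).
  assert (H1 : 0 <= psum (fun i => lev1 sg a b i x) (a * a)) by (apply psum_ge0; intros; apply Hpos).
  assert (H2 : 0 <= psum (fun i => lev2 sg a b i x) (3 ^ a)) by (apply psum_ge0; intros; apply Hpos).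
  assert (H0 : 0 <= lev0 sg a b x) by apply Hpos.
  assert (Hlt : lev0 sg a b x + psum (fun i => lev1 sg a b i x) (a * a)
                 + psum (fun j => lev2 sg a b j x) (3 ^ a) < 1).
  { refine (psum_pos_lt1 _ _ _ Hlev b _); [|unfold b; lia].
    intros b' _. simpl.
    pose proof (psum_ge0 (fun i => lev1 sg a b' i x) (a * a) (fun _ _ => Hpos _ _ _ _)).
    pose proof (psum_ge0 (fun i => lev2 sg a b' i x) (3 ^ a) (fun _ _ => Hpos _ _ _ _)).
    assert (0 <= lev0 sg a b' x) by apply Hpos. lra. }
  assert (L1 : lev1 sg a b i x < 1).
  { apply (psum_pos_lt1 (fun i => lev1 sg a b i x) (a * a)); auto; [intros; apply Hpos|lra]. }
  assert (L2 : lev2 sg a b j x < 1).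
  { apply (psum_pos_lt1 (fun i => lev2 sg a b i x) (3 ^ a)); auto; [intros; apply Hpos|lra]. }
  assert (Ha3 : 3 <= INR a) by (apply INR_ge_three; auto).
  pose proof (ln_ge_one _ Ha3) as Hln.
  assert (HP : 0 < 3 ^ a) by (apply pow_lt; lra).
  assert (Hm1 : 1 <= INR m) by apply INR_ge_one, m_pos.
  pose proof (INR_base a b) as Hbase. pose proof (pos_INR b).
  assert (Hbp : 3 ^ a * INR m <= INR (base a b)) by nra.
  apply tail_lt1 in L2; [|apply Rdiv_lt_0_compat; [lra|apply sqrt_lt_R0; auto]].
  apply tail_lt1 in L1;
    [|apply Rmult_lt_0_compat; [lra|]; apply sqrt_lt_R0, Rdiv_lt_0_compat; lra].
  assert (L0 : lev0 sg a b x < 1) by lra.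
  apply tail_lt1 in L0;
    [|apply Rmult_lt_0_compat; [lra|]; apply sqrt_lt_R0, Rdiv_lt_0_compat; nra].
  fold i in L2. rewrite <- HNb in L2.
  assert (HS0 : perm_sum 0 x = 0) by reflexivity. rewrite HS0 in L0.
  assert (Hbn : INR (base a b) <= INR N) by (apply le_INR; lia).
  assert (Hll : ln (INR a) <= ln (ln (INR N))).
  { apply ln_le; [lra|]. apply exp_le_inv. rewrite exp_ln by nra.
    pose proof (exp_nat a). nra. }
  assert (HB0 : sqrt (INR (base a b) * ln (INR a)) <= sqrt (INR N * ln (ln (INR N)))).
  { apply sqrt_le_1_alt. apply Rmult_le_compat; nra. }
  assert (HB1 : sqrt (3 ^ a * INR m * ln (INR a)) <= sqrt (INR N * ln (ln (INR N)))).
  { apply sqrt_le_1_alt. apply Rmult_le_compat; nra. }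
  unfold th0 in L0. unfold th1 in L1, L2. nra.
Qed.

Lemma upper_half_m sg : sg * sg = 1 -> lebesgue_null (fun x => 0 < x < 1 /\
  ~ exists N0, forall N, (N0 <= N)%nat ->
    sg * perm_sum N x <= (1 + 3 * eta) * sqrt (INR N * ln (ln (INR N)))).
Proof.
  intros Hsg. destruct (level_bound sg Hsg) as [a0 Ha0].
  eapply lebesgue_null_mono; [|eapply (borel_cantelli (level sg) _ a0)].
  - intros x [Hx Hn]. split; [exact Hx|]. intros k1. apply NNPP. intros Hk. apply Hn.
    set (a1 := Nat.max 3 k1).
    exists (3 ^ a1 * m)%nat. intros N HN.
    pose proof m_pos as Hmp.
    assert (Ha : exists a, (a1 <= a)%nat /\ (3 ^ a * m <= N < 3 ^ S a * m)%nat).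
    { assert (Hd : forall d, (N < 3 ^ (a1 + d) * m)%nat -> exists a, (a1 <= a)%nat /\ (3 ^ a * m <= N < 3 ^ S a * m)%nat).
      { induction d as [|d IH]; intros Hlt; [rewrite Nat.add_0_r in Hlt; lia|].
        destruct (le_lt_dec (3 ^ (a1 + d) * m) N) as [h|h]; [|auto].
        exists (a1 + d)%nat. split; [lia|]. replace (S (a1 + d)) with (a1 + S d)%nat by lia. lia. }
      apply (Hd N). pose proof (Nat.pow_gt_lin_r 3 (a1 + N) ltac:(lia)). nia. }
    destruct Ha as (a & Haa & HaN). apply (level_lt1 sg a x N); auto; [unfold a1 in Haa; lia|].
    apply Rnot_le_lt. intros Hle. apply Hk. exists a. split; [unfold a1 in Haa; lia|auto].
  - intros a. unfold level. cont; apply cont_tail.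
  - intros; apply level_ge0.
  - exact Ha0.
  - apply (ex_series_scal (V := R_NormedModule)).
    apply (ex_series_plus (V := R_NormedModule)); [apply (ex_series_plus (V := R_NormedModule))|].
    + apply ex_series_ln_pow; lra.
    + apply ex_series_ln_pow; lra.
    + apply (ex_series_scal (V := R_NormedModule)). apply ex_series_geom. rewrite Rabs_pos_eq; lra.
Qed.

End Upper.

(** The sign -1 serves the lower bound, where the sum preceding a large block must not be too
    negative. *)
Lemma upper_half n q sigma eta sg : hadamard_gap n q ->
  (forall i j, sigma i = sigma j -> i = j) -> 0 < eta <= 1 -> sg * sg = 1 ->
  lebesgue_null (fun x => 0 < x < 1 /\
  ~ exists N0, forall N, (N0 <= N)%nat ->
    sg * perm_sum n sigma N x <= (1 + 3 * eta) * sqrt (INR N * ln (ln (INR N)))).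
Proof.
  intros Hgap Hs He Hsg.
  destruct (INR_unbounded (9 / (eta * eta))) as [m Hm].
  apply (upper_half_m n q Hgap sigma Hs eta He m); auto.
  apply Rlt_le, (Rmult_le_compat_l (eta * eta)) in Hm; [|nra].
  replace (eta * eta * (9 / (eta * eta))) with 9 in Hm by (field; lra). lra.
Qed.

(** * The lower bound *)

(** Above the cap [e^t] one has [e^z <= e^z * e^(p(z-t))], so the mass lost by truncation is
    controlled by a moment of order [1 + p]. *)
Lemma min_exp_ge z t p : 0 <= p ->
  exp z - exp ((1 + p) * z - p * t) <= Rmin (exp z) (exp t).
Proof.
  intros Hp. pose proof (exp_pos ((1 + p) * z - p * t)).
  destruct (Rle_dec z t) as [h|h].
  - rewrite Rmin_left by (apply exp_le; auto). lra.
  - assert (exp z <= exp ((1 + p) * z - p * t)) by (apply exp_le; nra).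
    pose proof (Rmin_glb (exp z) (exp t) 0 ltac:(left; apply exp_pos) ltac:(left; apply exp_pos)).
    lra.
Qed.

Lemma exp_small_bounds d : 0 <= d <= / 4 -> exp d <= 1 + 2 * d /\ 1 - d <= exp (- d) /\ exp (2 * d) <= 2.
Proof.
  intros Hd.
  assert (H : forall t, exp t * exp (- t) = 1).
  { intros t. rewrite <- exp_plus, Rplus_opp_r. apply exp_0. }
  pose proof (H d) as H1. pose proof (H (2 * d)) as H2.
  pose proof (exp_ineq1_le (- d)). pose proof (exp_ineq1_le (- (2 * d))).
  pose proof (exp_pos d). pose proof (exp_pos (2 * d)).
  assert ((1 - d) * exp d <= 1) by nra.
  assert ((1 - 2 * d) * exp (2 * d) <= 1) by nra.
  repeat split; try lra; nra.
Qed.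

Section Lower.
Context (n : nat -> nat) (q : R) (Hgap : hadamard_gap n q).
Context (sigma : nat -> nat) (Hsigma : forall i j, sigma i = sigma j -> i = j).
Context (r : nat) (Hr : 3 + 3 / (q - 1) < q ^ r).

Local Notation perm_sum' := (perm_sum n sigma).
Local Notation lsum' := (lsum n sigma).

Definition keep (L o m : nat) : R := if lt_dec ((m + o) mod L) r then 0 else 1.

Lemma keep_01 L o m : keep L o m = 0 \/ keep L o m = 1.
Proof. unfold keep. destruct lt_dec; auto. Qed.

(** The permutation may spread a block unevenly over the residues mod [L], so no fixed offset serves
    all blocks. Averaged over the offsets, exactly the fraction [1 - r/L] survives, and some offset
    does at least as well. *)
Lemma good_offset L A B : (1 <= L)%nat -> (r <= L)%nat -> (A <= B)%nat ->
  exists o, (o < L)%nat /\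
    (INR L - INR r) * (INR B - INR A) <= INR L * psum (fun i => indic A B i * keep L o (sigma i)) B.
Proof.
  intros HL HrL HAB. apply NNPP. intros Hn.
  set (Q := fun o => psum (fun i => indic A B i * keep L o (sigma i)) B).
  assert (HQ : psum Q L = (INR L - INR r) * (INR B - INR A)).
  { unfold Q. rewrite psum_swap.
    rewrite (psum_ext _ (fun i => (INR L - INR r) * (indic A B i * 1))).
    - rewrite psum_scal, psum_indic by lia. rewrite !psum_const. ring.
    - intros i _. rewrite psum_scal. unfold keep.
      rewrite (psum_mod_shift (fun u => if lt_dec u r then 0 else 1)) by lia.
      rewrite psum_good by lia. ring. }
  assert (Hlt : forall o, (o < L)%nat -> INR L * Q o < psum Q L).
  { intros o Ho. rewrite HQ. apply Rnot_le_lt. intros h. apply Hn. exists o. auto. }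
  assert (forall l, (1 <= l <= L)%nat -> INR L * psum Q l < INR l * psum Q L).
  { induction l as [|l IH]; intros Hl; [lia|]. rewrite S_INR, psum_S.
    specialize (Hlt l ltac:(lia)). destruct l as [|l]; [simpl; lra|].
    specialize (IH ltac:(lia)). lra. }
  specialize (H L ltac:(lia)). lra.
Qed.

Context (eta : R) (Heta : 0 < eta <= / 2) (T : nat) (HT : (9 <= T)%nat).

Definition Hlen (k : nat) : R := INR (T ^ S k) - INR (T ^ k).

Lemma Hlen_eq k : Hlen k = (INR T - 1) * INR T ^ k.
Proof. unfold Hlen. rewrite !pow_INR. simpl. ring. Qed.

Lemma T_ge : 9 <= INR T.
Proof. apply le_INR in HT. simpl in HT. lra. Qed.

Lemma Hlen_pos k : 0 < Hlen k.
Proof.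
  rewrite Hlen_eq. pose proof T_ge. pose proof (pow_lt (INR T) k ltac:(lra)). nra.
Qed.

Lemma Hlen_mono j k : (j <= k)%nat -> Hlen j <= Hlen k.
Proof.
  intros H. rewrite !Hlen_eq. pose proof T_ge. pose proof (Rle_pow (INR T) j k ltac:(lra) H). nra.
Qed.

Definition bad (K : nat) (x : R) : Prop := forall k, (K <= k < 2 * K)%nat ->
  perm_sum' (T ^ S k) x - perm_sum' (T ^ k) x < (1 - 2 * eta) * sqrt (Hlen k * ln (INR K)).

(** Error of the upper moment estimate with [L = K], coefficients up to [4 sqrt (ln K / Hlen K)] and
    [V <= 16 ln K]. These limits cover a tilt raised to a power up to 2, a product of two tilts, and
    a tilt times its loss factor. *)
Definition err (K : nat) : R :=
  (2 * INR r / INR K + 16 * INR K ^ 2 * (4 * sqrt (ln (INR K) / Hlen K))) * (16 * ln (INR K)).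

(** * Second moments over a window of K blocks *)

Section Window.
Context (K : nat) (HK3 : (3 <= K)%nat) (HKr : (2 * r <= K)%nat).
Context (d : R) (Hd : 0 < d <= / 4) (Herr : err K <= d).
Context (Hw : exp (- (eta * eta / 2) * ln (INR K)) <= d).
Context (o : nat -> nat) (Ho : forall k, (o k < K)%nat /\
  (INR K - INR r) * (INR (T ^ S k) - INR (T ^ k)) <=
  INR K * psum (fun i => indic (T ^ k) (T ^ S k) i * keep K (o k) (sigma i)) (T ^ S k)).

Let l := ln (INR K).
Let M := (T ^ (2 * K))%nat.
Let cs := 4 * sqrt (l / Hlen K).
Let e := err K.

Lemma K_ge : 3 <= INR K.
Proof. apply INR_ge_three; auto. Qed.

Lemma l_ge : 1 <= l.
Proof. apply ln_ge_one, K_ge. Qed.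

Lemma cs_ge0 : 0 <= cs.
Proof. unfold cs. pose proof (sqrt_pos (l / Hlen K)). lra. Qed.

Lemma err_parts : 0 <= e /\ 16 * INR K ^ 2 * cs * (16 * l) <= e /\ 2 * INR r / INR K * (16 * l) <= e.
Proof.
  unfold e, err. fold l cs. pose proof K_ge. pose proof l_ge. pose proof cs_ge0. pose proof (pos_INR r).
  assert (0 <= 2 * INR r / INR K) by (apply Rdiv_le_0_compat; lra).
  assert (0 <= INR K ^ 2) by (apply pow_le; lra).
  assert (0 <= 16 * INR K ^ 2 * cs) by (apply Rmult_le_pos; lra).
  repeat split; nra.
Qed.

(** Read off from [err K <= 1/4], whose second part dominates [256 (K cs)(K l)] with [K l >= 3]. *)
Lemma cs_small : 2 * INR K * cs <= / 2.
Proof.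
  destruct err_parts as (_ & H & _). pose proof K_ge. pose proof l_ge. pose proof cs_ge0.
  unfold e in H. assert (Hq : 16 * INR K ^ 2 * cs * (16 * l) <= / 4) by lra.
  assert (0 <= INR K * cs) by nra.
  replace (16 * INR K ^ 2 * cs * (16 * l)) with (256 * (INR K * cs) * (INR K * l)) in Hq by ring.
  assert (3 <= INR K * l) by nra. nra.
Qed.

Lemma mgf_window_upper a c : (forall i, Rabs (a i) <= cs) ->
  psum (fun i => Rsqr (a i)) M <= 16 * l -> psum (fun i => Rsqr (a i)) M / 4 + e <= c ->
  E (fun x => exp (lsum' a M x)) <= exp c.
Proof.
  intros Ha HV Hc. eapply Rle_trans.
  - apply (mgf_perm_upper n q Hgap r Hr sigma Hsigma a M K cs); auto; try lia.
    + apply cs_ge0.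
    + apply cs_small.
  - apply exp_le. eapply Rle_trans; [|exact Hc]. apply Rplus_le_compat_l.
    unfold e, err. fold l cs. apply Rmult_le_compat_l; auto.
    pose proof K_ge. pose proof cs_ge0. pose proof (pos_INR r).
    assert (0 <= 2 * INR r / INR K) by (apply Rdiv_le_0_compat; lra).
    assert (0 <= INR K ^ 2) by (apply pow_le; lra). nra.
Qed.

Let v k i := indic (T ^ k) (T ^ S k) i * keep K (o k) (sigma i).
Let g k := sqrt (l / Hlen k).
(** Tilting by [lam] shifts the mean of the block sum to about [lam * hh / 2], close to
    [(1 - eta) sqrt (Hlen * l)]. This exceeds the threshold [s] by [delta = eta * sqrt (Hlen * l)],
    and [mu] minimises the Chernoff exponent [- mu * delta + mu^2 * Hlen / 4], with minimum
    [- eta^2 * l]. *)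
Let lam k := 2 * (1 - eta) * g k.
Let mu k := 2 * eta * g k.
Let hh k := psum (v k) M.
Let s k := (1 - 2 * eta) * sqrt (Hlen k * l).

Lemma v_01 k i : v k i = 0 \/ v k i = 1.
Proof. unfold v. destruct (indic_01 (T ^ k) (T ^ S k) i) as [-> | ->], (keep_01 K (o k) (sigma i)) as [-> | ->]; lra. Qed.

Lemma v_indic k i : v k i * indic (T ^ k) (T ^ S k) i = v k i.
Proof. unfold v. destruct (indic_01 (T ^ k) (T ^ S k) i) as [-> | ->]; ring. Qed.

Lemma T_pow_le k : (T ^ k <= T ^ S k)%nat.
Proof. apply Nat.pow_le_mono_r; lia. Qed.

Lemma v_disjoint j k i : j <> k -> v j i * v k i = 0.
Proof.
  intros Hjk. unfold v, indic.
  destruct (le_dec (T ^ j) i); [|ring]. destruct (lt_dec i (T ^ S j)); [|ring].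
  destruct (le_dec (T ^ k) i); [|ring]. destruct (lt_dec i (T ^ S k)); [|ring].
  exfalso. destruct (lt_dec j k).
  - pose proof (Nat.pow_le_mono_r T (S j) k ltac:(lia) ltac:(lia)). lia.
  - pose proof (Nat.pow_le_mono_r T (S k) j ltac:(lia) ltac:(lia)). lia.
Qed.

Section Index.
Context (k : nat) (Hk : (K <= k < 2 * K)%nat).

Lemma M_ge : (T ^ k <= T ^ S k <= M)%nat.
Proof. split; [apply T_pow_le|]. apply Nat.pow_le_mono_r; lia. Qed.

Lemma sum_indic : psum (indic (T ^ k) (T ^ S k)) M = Hlen k.
Proof.
  rewrite (psum_ext _ (fun i => indic (T ^ k) (T ^ S k) i * 1)) by (intros; ring).
  rewrite psum_indic by apply M_ge. rewrite !psum_const. unfold Hlen. ring.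
Qed.

Lemma hh_bounds : 0 <= hh k <= Hlen k /\ (INR K - INR r) * Hlen k <= INR K * hh k.
Proof.
  assert (Hle : psum (v k) (T ^ S k) <= hh k).
  { apply psum_mono; [|apply M_ge]. intros i. destruct (v_01 k i); lra. }
  repeat split.
  - apply psum_ge0. intros i _. destruct (v_01 k i); lra.
  - rewrite <- sum_indic. apply psum_le. intros i _. unfold v.
    destruct (indic_01 (T ^ k) (T ^ S k) i) as [-> | ->], (keep_01 K (o k) (sigma i)) as [-> | ->]; lra.
  - destruct (Ho k) as [_ H]. fold (Hlen k) in H. pose proof K_ge.
    eapply Rle_trans; [exact H|]. apply Rmult_le_compat_l; [lra|]. exact Hle.
Qed.

Lemma g_facts : 0 <= g k /\ 4 * g k <= cs /\ g k * g k * Hlen k = l /\ g k * sqrt (Hlen k * l) = l.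
Proof.
  pose proof (Hlen_pos k). pose proof l_ge. repeat split.
  - apply sqrt_pos.
  - unfold cs, g. apply Rmult_le_compat_l; [lra|]. apply sqrt_le_1_alt. unfold Rdiv.
    apply Rmult_le_compat_l; [lra|]. apply Rinv_le_contravar; [apply Hlen_pos|].
    apply Hlen_mono. lia.
  - unfold g. rewrite sqrt_sqrt by (apply Rdiv_le_0_compat; lra). field. lra.
  - unfold g. apply sqrt_sub_mult; lra.
Qed.

Lemma ghh : 0 <= g k * g k * hh k <= l.
Proof.
  destruct g_facts as (H0 & _ & H1 & _). destruct hh_bounds as [[H2 H3] _].
  split; [apply Rmult_le_pos; nra|]. rewrite <- H1. apply Rmult_le_compat_l; nra.
Qed.

Lemma psum_sq_v c : psum (fun i => Rsqr (c * v k i)) M = c * c * hh k.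
Proof.
  unfold hh. rewrite <- psum_scal. apply psum_ext. intros i _. unfold Rsqr.
  destruct (v_01 k i) as [-> | ->]; ring.
Qed.

(** Normalised by the Gaussian value instead of the true mean: [E tilt] is 1 only up to [exp e], but
    normalisations multiply exactly in products. *)
Definition tilt (x : R) : R := exp (lam k * lsum' (v k) M x - lam k * lam k * hh k / 4).

Lemma cont_tilt : continuity tilt.
Proof. unfold tilt. cont. Qed.

Lemma lsum_scal c a N x : c * lsum' a N x = lsum' (fun i => c * a i) N x.
Proof. unfold lsum. rewrite <- psum_scal. apply psum_ext; intros; ring. Qed.

Lemma E_tilt_power c t u : 0 <= c <= 2 ->
  c * c * (lam k * lam k * hh k / 4) - t + e <= u ->
  E (fun x => exp (c * (lam k * lsum' (v k) M x) - t)) <= exp u.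
Proof.
  intros Hc Hu.
  destruct g_facts as (H0 & H1 & _ & _). pose proof ghh as Hg.
  assert (Hlam : 0 <= lam k <= 2 * g k) by (unfold lam; nra).
  assert (HVb : lam k * lam k * hh k <= 4 * l).
  { unfold lam. replace (2 * (1 - eta) * g k * (2 * (1 - eta) * g k) * hh k)
      with (4 * ((1 - eta) * (1 - eta)) * (g k * g k * hh k)) by ring.
    assert ((1 - eta) * (1 - eta) <= 1) by nra. nra. }
  assert (HV0 : 0 <= lam k * lam k * hh k) by (apply Rmult_le_pos; [nra|apply hh_bounds]).
  rewrite (E_ext _ (fun x => exp (- t) * exp (lsum' (fun i => c * lam k * v k i) M x))).
  - rewrite E_scal by (cont; apply cont_lsum).
    replace u with (- t + (u + t)) by ring. rewrite exp_plus.
    apply Rmult_le_compat_l; [left; apply exp_pos|].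
    apply mgf_window_upper.
    + intros i. rewrite Rabs_mult.
      rewrite (Rabs_pos_eq (c * lam k)) by nra.
      assert (c * lam k <= cs) by nra. pose proof cs_ge0.
      destruct (v_01 k i) as [-> | ->]; rewrite ?Rabs_R0, ?Rabs_R1; lra.
    + rewrite psum_sq_v.
      replace (c * lam k * (c * lam k) * hh k) with (c * c * (lam k * lam k * hh k)) by ring.
      assert (c * c <= 4) by nra. nra.
    + rewrite psum_sq_v. lra.
  - intros x. rewrite <- lsum_scal, <- exp_plus. f_equal. ring.
Qed.

Lemma E_tilt_le : E tilt <= exp e.
Proof.
  unfold tilt. rewrite (E_ext _ (fun x => exp (1 * (lam k * lsum' (v k) M x) - lam k * lam k * hh k / 4))).
  - apply E_tilt_power; lra.
  - intros; f_equal; ring.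
Qed.

Lemma E_tilt_ge : exp (- e) <= E tilt.
Proof.
  destruct g_facts as (H0 & H1 & _ & _). pose proof ghh as Hg.
  assert (Hlam : 0 <= lam k <= 2 * g k) by (unfold lam; nra).
  unfold tilt.
  rewrite (E_ext _ (fun x => exp (- (lam k * lam k * hh k / 4)) * exp (lsum' (fun i => lam k * v k i) M x))).
  2:{ intros x. rewrite <- lsum_scal, <- exp_plus. f_equal. ring. }
  rewrite E_scal by (cont; apply cont_lsum).
  replace (- e) with (- (lam k * lam k * hh k / 4) + (lam k * lam k * hh k / 4 - e)) by ring.
  rewrite exp_plus. apply Rmult_le_compat_l; [left; apply exp_pos|].
  pose proof cs_ge0. pose proof cs_small. pose proof K_ge.
  eapply Rle_trans; [|apply (mgf_perm_lower n q Hgap r Hr sigma Hsigma _ M K (o k) cs); auto; try lia; try nra].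
  - cbv beta. rewrite psum_sq_v. apply exp_le. destruct err_parts as (_ & He2 & _).
    assert (HVb : lam k * lam k * hh k <= 4 * l).
    { unfold lam. replace (2 * (1 - eta) * g k * (2 * (1 - eta) * g k) * hh k)
        with (4 * ((1 - eta) * (1 - eta)) * (g k * g k * hh k)) by ring.
      assert ((1 - eta) * (1 - eta) <= 1) by nra. nra. }
    assert (HV0 : 0 <= lam k * lam k * hh k) by (apply Rmult_le_pos; [nra|apply hh_bounds]).
    assert (0 <= INR K ^ 2 * cs) by (apply Rmult_le_pos; [apply pow_le|]; lra).
    replace (2 * INR K ^ 2 * cs * (lam k * lam k * hh k))
      with (2 * (INR K ^ 2 * cs) * (lam k * lam k * hh k)) by ring.
    replace (16 * INR K ^ 2 * cs * (16 * l)) with (256 * (INR K ^ 2 * cs) * l) in He2 by ring. nra.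
  - apply Ho.
  - intros i _. rewrite Rabs_mult, Rabs_pos_eq by lra.
    destruct (v_01 k i) as [-> | ->]; rewrite ?Rabs_R0, ?Rabs_R1; lra.
  - intros i _ Hi. unfold v, keep. destruct lt_dec; [ring|lia].
Qed.

Definition trunc_tilt (x : R) : R := Rmin (tilt x) (exp ((1 - eta * eta) * l)).

Lemma cont_trunc_tilt : continuity trunc_tilt.
Proof. apply cont_min; [apply cont_tilt|apply cont_const]. Qed.

Lemma trunc_tilt_bounds x : 0 <= trunc_tilt x <= tilt x /\ trunc_tilt x <= exp ((1 - eta * eta) * l).
Proof.
  unfold trunc_tilt. repeat split; [|apply Rmin_l|apply Rmin_r].
  apply Rmin_glb; left; apply exp_pos.
Qed.

Lemma E_trunc_tilt_ge : exp (- e) - exp (- (eta * eta / 2) * l + e) <= E trunc_tilt.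
Proof.
  set (z := fun x => lam k * lsum' (v k) M x - lam k * lam k * hh k / 4).
  set (B := fun x => exp ((1 + eta) * z x - eta * ((1 - eta * eta) * l))).
  assert (HB : E B <= exp (- (eta * eta / 2) * l + e)).
  { unfold B, z.
    rewrite (E_ext _ (fun x => exp ((1 + eta) * (lam k * lsum' (v k) M x) -
       ((1 + eta) * (lam k * lam k * hh k / 4) + eta * ((1 - eta * eta) * l))))).
    - apply E_tilt_power; [lra|]. pose proof l_ge. pose proof ghh as Hg.
      replace (lam k * lam k * hh k / 4) with ((1 - eta) * (1 - eta) * (g k * g k * hh k))
        by (unfold lam; field).
      set (G := g k * g k * hh k) in *.
      assert (HG : (1 - eta) * (1 - eta) * G <= (1 - eta) * (1 - eta) * l) by nra.
      set (J := (1 - eta) * (1 - eta) * G) in *.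
      assert (eta * (1 + eta) * J <= eta * (1 + eta) * ((1 - eta) * (1 - eta) * l)) by nra.
      (* The left side is [- eta^2 (1 - eta^2) l], and [1 - eta^2 >= 1/2]. *)
      assert (eta * (1 + eta) * ((1 - eta) * (1 - eta) * l) - eta * ((1 - eta * eta) * l)
         <= - (eta * eta / 2) * l); [|lra].
      assert (0 <= (1 - eta * eta - / 2) * (eta * eta * l)) by (apply Rmult_le_pos; nra). nra.
    - intros x. f_equal. ring. }
  assert (HcB : continuity B) by (unfold B, z; cont; apply cont_lsum).
  assert (HE : E tilt <= E trunc_tilt + E B).
  { rewrite <- E_plus by (auto; apply cont_trunc_tilt). apply E_le; [apply cont_tilt|apply cont_plus; auto; apply cont_trunc_tilt|].
    intros x. pose proof (min_exp_ge (z x) ((1 - eta * eta) * l) eta ltac:(lra)) as H.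
    change (exp (z x)) with (tilt x) in H. unfold trunc_tilt, B. lra. }
  pose proof E_tilt_ge. lra.
Qed.

Lemma E_trunc_tilt_sq : E (fun x => trunc_tilt x * trunc_tilt x) <= exp ((1 - eta * eta) * l + e).
Proof.
  rewrite exp_plus. apply Rle_trans with (E (fun x => exp ((1 - eta * eta) * l) * tilt x)).
  - apply E_le.
    + apply cont_mult; apply cont_trunc_tilt.
    + apply cont_mult; [apply cont_const|apply cont_tilt].
    + intros x. destruct (trunc_tilt_bounds x) as [[? ?] ?]. apply Rmult_le_compat; auto.
  - rewrite E_scal by apply cont_tilt. apply Rmult_le_compat_l; [left; apply exp_pos|apply E_tilt_le].
Qed.

Definition tilt_loss (x : R) : R := tilt x * exp (- mu k * (perm_sum' (T ^ S k) x - perm_sum' (T ^ k) x - s k)).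

Lemma cont_tilt_loss : continuity tilt_loss.
Proof. unfold tilt_loss. apply cont_mult; [apply cont_tilt|]. cont; apply cont_perm_sum. Qed.

(** The tilt sees only the kept indices, the loss factor the whole block, so the cross term in [V]
    carries [hh] in place of [Hlen]. The missing fraction, at most [r/K], accounts for the second
    [e]. *)
Lemma E_tilt_loss : E tilt_loss <= exp (- (eta * eta) * l + 2 * e).
Proof.
  destruct g_facts as (H0 & H1 & H2 & H3). pose proof ghh as Hg. destruct hh_bounds as [[Hh0 Hh1] Hh2].
  pose proof l_ge. pose proof K_ge. pose proof cs_ge0.
  set (a := fun i => lam k * v k i - mu k * indic (T ^ k) (T ^ S k) i).
  assert (Hlam : 0 <= lam k <= 2 * g k) by (unfold lam; nra).
  assert (Hmu : 0 <= mu k <= 2 * g k) by (unfold mu; nra).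
  assert (HV : psum (fun i => Rsqr (a i)) M =
     lam k * lam k * hh k - 2 * lam k * mu k * hh k + mu k * mu k * Hlen k).
  { rewrite <- sum_indic. unfold hh.
    rewrite (psum_ext _ (fun i => (lam k * lam k - 2 * lam k * mu k) * v k i
       + mu k * mu k * indic (T ^ k) (T ^ S k) i)).
    - rewrite psum_plus, !psum_scal. ring.
    - intros i _. unfold a, Rsqr. pose proof (v_indic k i) as Hvi.
      destruct (v_01 k i) as [-> | Hv1]; destruct (indic_01 (T ^ k) (T ^ S k) i) as [Hi | Hi];
        rewrite ?Hv1, Hi in *; lra. }
  rewrite (E_ext _ (fun x => exp (mu k * s k - lam k * lam k * hh k / 4) * exp (lsum' a M x))).
  2:{ intros x. unfold tilt_loss, tilt. rewrite <- !exp_plus. f_equal.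
      unfold a, lsum, perm_sum.
      rewrite <- (psum_indic (fun i => cosf (n (sigma i)) x) (T ^ k) (T ^ S k) M) by apply M_ge.
      rewrite (psum_ext (fun i => (lam k * v k i - mu k * indic (T ^ k) (T ^ S k) i) * _)
        (fun i => lam k * (v k i * cosf (n (sigma i)) x)
           + - mu k * (indic (T ^ k) (T ^ S k) i * cosf (n (sigma i)) x))) by (intros; ring).
      rewrite psum_plus, !psum_scal. ring. }
  rewrite E_scal by (cont; apply cont_lsum).
  replace (- (eta * eta) * l + 2 * e) with ((mu k * s k - lam k * lam k * hh k / 4)
    + ((- (eta * eta) * l + 2 * e) - (mu k * s k - lam k * lam k * hh k / 4))) by ring.
  rewrite exp_plus. apply Rmult_le_compat_l; [left; apply exp_pos|].
  assert (Hmuh : mu k * mu k * Hlen k = 4 * (eta * eta) * l).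
  { unfold mu. rewrite <- H2. ring. }
  assert (Hll : lam k * lam k * hh k <= 4 * l).
  { unfold lam. replace (2 * (1 - eta) * g k * (2 * (1 - eta) * g k) * hh k)
      with (4 * ((1 - eta) * (1 - eta)) * (g k * g k * hh k)) by ring.
    assert ((1 - eta) * (1 - eta) <= 1) by nra. nra. }
  assert (Hlm : 0 <= lam k * mu k * hh k) by (apply Rmult_le_pos; nra).
  apply mgf_window_upper.
  - intros i. unfold a. destruct (v_01 k i) as [-> | ->], (indic_01 (T ^ k) (T ^ S k) i) as [-> | ->];
      apply Rabs_le; lra.
  - rewrite HV, Hmuh. assert (eta * eta <= 1) by nra. nra.
  - rewrite HV, Hmuh.
    assert (Hms : mu k * s k = 2 * eta * (1 - 2 * eta) * l).
    { unfold mu, s. replace (2 * eta * g k * ((1 - 2 * eta) * sqrt (Hlen k * l)))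
        with (2 * eta * (1 - 2 * eta) * (g k * sqrt (Hlen k * l))) by ring. rewrite H3. ring. }
    rewrite Hms.
    assert (Hlmh : lam k * mu k * hh k = 4 * eta * (1 - eta) * (g k * g k * hh k)) by (unfold lam, mu; ring).
    destruct err_parts as (He0 & _ & He).
    set (rk := INR r / INR K) in *. pose proof (pos_INR r).
    assert (Hrk : 0 <= rk) by (apply Rdiv_le_0_compat; lra).
    replace (2 * INR r / INR K) with (2 * rk) in He by (unfold rk; field; lra).
    assert (Hgk : (1 - rk) * l <= g k * g k * hh k).
    { apply Rmult_le_reg_l with (INR K); [lra|].
      replace (INR K * ((1 - rk) * l)) with ((INR K - INR r) * l) by (unfold rk; field; lra).
      rewrite <- H2.
      replace ((INR K - INR r) * (g k * g k * Hlen k)) with ((g k * g k) * ((INR K - INR r) * Hlen k)) by ring.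
      replace (INR K * (g k * g k * hh k)) with ((g k * g k) * (INR K * hh k)) by ring.
      apply Rmult_le_compat_l; [nra|auto]. }
    set (G := g k * g k * hh k) in *.
    assert (0 <= eta * (1 - eta) <= / 4) by nra.
    assert (2 * eta * (1 - eta) * G >= 2 * eta * (1 - eta) * ((1 - rk) * l)) by nra.
    assert (0 <= rk * l) by nra.
    assert (2 * (eta * (1 - eta)) * (rk * l) <= e) by nra.
    replace (2 * lam k * mu k * hh k) with (2 * (lam k * mu k * hh k)) by ring.
    rewrite Hlmh. nra.
Qed.

End Index.

(** The two blocks use disjoint indices, so the values of [V] add and the normalisations cancel.
    Their offsets may differ and leave no common gaps; this is harmless, since the upper moment
    estimate asks for none. *)
Lemma E_tilt_cross j k : (K <= j < 2 * K)%nat -> (K <= k < 2 * K)%nat -> j <> k ->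
  E (fun x => tilt j x * tilt k x) <= exp e.
Proof.
  intros Hj Hk Hjk.
  assert (Hf : forall k, (K <= k < 2 * K)%nat -> 0 <= 4 * lam k <= 2 * cs /\ 0 <= lam k * lam k * hh k <= 4 * l).
  { clear j k Hj Hk Hjk. intros k Hk. destruct (g_facts k Hk) as (H0 & H1 & _ & _). pose proof (ghh k Hk) as Hg.
    assert (Hlam : 0 <= lam k <= 2 * g k) by (unfold lam; nra).
    split; [lra|]. split; [apply Rmult_le_pos; [nra|apply hh_bounds; auto]|].
    unfold lam. replace (2 * (1 - eta) * g k * (2 * (1 - eta) * g k) * hh k)
      with (4 * ((1 - eta) * (1 - eta)) * (g k * g k * hh k)) by ring.
    assert ((1 - eta) * (1 - eta) <= 1) by nra. nra. }
  destruct (Hf j Hj) as [Hj1 Hj2], (Hf k Hk) as [Hk1 Hk2].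
  set (a := fun i => lam j * v j i + lam k * v k i).
  set (t := lam j * lam j * hh j / 4 + lam k * lam k * hh k / 4).
  assert (HV : psum (fun i => Rsqr (a i)) M = 4 * t).
  { replace (4 * t) with (lam j * lam j * hh j + lam k * lam k * hh k) by (unfold t; field).
    rewrite <- !psum_sq_v, <- psum_plus. apply psum_ext. intros i _. unfold a, Rsqr.
    transitivity (lam j * v j i * (lam j * v j i) + lam k * v k i * (lam k * v k i)
      + 2 * lam j * lam k * (v j i * v k i)); [ring|].
    rewrite (v_disjoint j k i Hjk). ring. }
  rewrite (E_ext _ (fun x => exp (- t) * exp (lsum' a M x))).
  - rewrite E_scal by (cont; apply cont_lsum).
    replace e with (- t + (t + e)) by ring. rewrite exp_plus.
    apply Rmult_le_compat_l; [left; apply exp_pos|]. pose proof l_ge. pose proof cs_ge0.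
    apply mgf_window_upper; rewrite ?HV.
    + intros i. unfold a. destruct (v_01 j i) as [-> | ->], (v_01 k i) as [-> | ->]; apply Rabs_le; lra.
    + unfold t. lra.
    + lra.
  - intros x. unfold tilt, a. rewrite <- !exp_plus. f_equal. unfold lsum.
    rewrite (psum_ext (fun i => (lam j * v j i + lam k * v k i) * _)
       (fun i => lam j * (v j i * cosf (n (sigma i)) x) + lam k * (v k i * cosf (n (sigma i)) x)))
      by (intros; ring).
    rewrite psum_plus, !psum_scal. unfold t. ring.
Qed.

Definition mean_tilt (x : R) : R := / INR K * psum (fun i => trunc_tilt (K + i) x) K.
Definition mean_loss (x : R) : R := / INR K * psum (fun i => tilt_loss (K + i) x) K.

(* On [bad K] one has [mean_tilt <= mean_loss], so either [mean_loss >= 1/2] or [mean_tilt]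
   deviates from its mean, which is close to 1. *)
Definition detector (x : R) : R := 2 * mean_loss x + 4 * ((mean_tilt x - 1) * (mean_tilt x - 1)).

Lemma cont_mean_tilt : continuity mean_tilt.
Proof. unfold mean_tilt. cont. Qed.

Lemma cont_mean_loss : continuity mean_loss.
Proof. unfold mean_loss. cont. Qed.

Lemma cont_detector : continuity detector.
Proof. unfold detector. cont; try apply cont_mean_loss; apply cont_mean_tilt. Qed.

Lemma tilt_loss_pos k x : 0 < tilt_loss k x.
Proof. apply Rmult_lt_0_compat; apply exp_pos. Qed.

Lemma mean_loss_ge0 x : 0 <= mean_loss x.
Proof.
  apply Rmult_le_pos; [left; apply Rinv_0_lt_compat; pose proof K_ge; lra|].
  apply psum_ge0. intros; left; apply tilt_loss_pos.
Qed.

Lemma detector_ge0 x : 0 <= detector x.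
Proof. unfold detector. pose proof (mean_loss_ge0 x). pose proof (Rle_0_sqr (mean_tilt x - 1)). unfold Rsqr in *. lra. Qed.

Lemma detector_bad x : bad K x -> 1 <= detector x.
Proof.
  intros Hb. assert (HZ : mean_tilt x <= mean_loss x).
  { unfold mean_tilt, mean_loss. apply Rmult_le_compat_l; [left; apply Rinv_0_lt_compat; pose proof K_ge; lra|].
    apply psum_le. intros i Hi. specialize (Hb (K + i)%nat ltac:(lia)).
    destruct (trunc_tilt_bounds (K + i) x) as [[_ HY] _]. eapply Rle_trans; [exact HY|].
    unfold tilt_loss. rewrite <- (Rmult_1_r (tilt (K + i) x)) at 1.
    apply Rmult_le_compat_l; [left; apply exp_pos|]. rewrite <- exp_0. apply exp_le.
    assert (0 <= mu (K + i)).
    { unfold mu. pose proof (g_facts (K + i) ltac:(lia)) as (H & _). apply Rmult_le_pos; [lra|exact H]. }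
    change (s (K + i)) with ((1 - 2 * eta) * sqrt (Hlen (K + i) * ln (INR K))). nra. }
  unfold detector. destruct (Rle_dec (/ 2) (mean_loss x)) as [h|h].
  { pose proof (Rle_0_sqr (mean_tilt x - 1)). unfold Rsqr in *. lra. }
  assert (1 - mean_tilt x >= / 2) by lra. pose proof (mean_loss_ge0 x).
  assert ((1 - mean_tilt x) * (1 - mean_tilt x) >= / 4) by nra. nra.
Qed.

Lemma exp_l : exp l = INR K.
Proof. apply exp_ln. pose proof K_ge; lra. Qed.

Lemma E_mean_tilt_sq : E (fun x => mean_tilt x * mean_tilt x) <= exp e + exp (- (eta * eta) * l + e).
Proof.
  pose proof K_ge as HK.
  assert (HKi : 0 < / INR K) by (apply Rinv_0_lt_compat; lra).
  rewrite (E_ext _ (fun x => / INR K * / INR K *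
     psum (fun i => psum (fun j => trunc_tilt (K + i) x * trunc_tilt (K + j) x) K) K)).
  2:{ intros x. unfold mean_tilt.
      rewrite (psum_ext (fun i => psum _ K) (fun i => psum (fun j => trunc_tilt (K + j) x) K * trunc_tilt (K + i) x)).
      2:{ intros i _. rewrite psum_scal. ring. }
      rewrite psum_scal. ring. }
  assert (HcY : forall i j, continuity (fun x => trunc_tilt i x * trunc_tilt j x)).
  { intros. apply cont_mult; apply cont_trunc_tilt. }
  rewrite E_scal, E_psum by (try (intros ? _); apply cont_psum; auto; intros; apply cont_psum; auto).
  rewrite (psum_ext _ (fun i => psum (fun j => E (fun x => trunc_tilt (K + i) x * trunc_tilt (K + j) x)) K)).
  2:{ intros. apply E_psum. auto. }
  apply Rle_trans with (/ INR K * / INR K * psum (fun i => INR K * exp e + exp ((1 - eta * eta) * l + e)) K).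
  - apply Rmult_le_compat_l; [nra|]. apply psum_le. intros i Hi.
    (* Each row has a single diagonal term, bounded by the cap [K^(1 - eta^2)]; after division by
       [K^2] the [K] rows contribute [K^(- eta^2)]. *)
    apply Rle_trans with (psum (fun j => exp e + delta_nat j i * exp ((1 - eta * eta) * l + e)) K).
    + apply psum_le. intros j Hj. unfold delta_nat. destruct (Nat.eq_dec j i) as [->|Hji].
      * pose proof (E_trunc_tilt_sq (K + i) ltac:(lia)). pose proof (exp_pos e). lra.
      * rewrite Rmult_0_l, Rplus_0_r.
        eapply Rle_trans; [|apply (E_tilt_cross (K + i) (K + j)); lia].
        apply E_le; auto; [apply cont_mult; apply cont_tilt|].
        intros x. destruct (trunc_tilt_bounds (K + i) x) as [? _], (trunc_tilt_bounds (K + j) x) as [? _].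
        apply Rmult_le_compat; lra.
    + rewrite psum_plus, psum_const.
      rewrite (psum_delta (fun _ => exp ((1 - eta * eta) * l + e)) i K). destruct lt_dec; [lra|lia].
  - rewrite psum_const.
    assert (Hx : exp ((1 - eta * eta) * l + e) = INR K * exp (- (eta * eta) * l + e)).
    { rewrite <- exp_l, <- exp_plus. f_equal. ring. }
    rewrite Hx. right. field. lra.
Qed.

(** The loss contributes [2 * 2d], the squared deviation [4 ((1 + 4d) - 2 (1 - 3d) + 1) = 40d]. *)
Lemma E_detector : E detector <= 44 * d.
Proof.
  pose proof K_ge as HK.
  assert (HKi : 0 < / INR K) by (apply Rinv_0_lt_compat; lra).
  assert (HE : E detector = 2 * E mean_loss + 4 * (E (fun x => mean_tilt x * mean_tilt x) - 2 * E mean_tilt + 1)).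
  { unfold detector.
    rewrite (E_ext _ (fun x => 2 * mean_loss x + (4 * (mean_tilt x * mean_tilt x) + ((- 8) * mean_tilt x + 4)))) by (intros; ring).
    pose proof cont_mean_loss. pose proof cont_mean_tilt.
    rewrite !E_plus, !E_scal, E_const by cont. ring. }
  assert (HDD : E mean_loss <= exp (- (eta * eta) * l + 2 * e)).
  { unfold mean_loss. rewrite E_scal, E_psum by (try (intros ? _); try apply cont_psum; intros; apply cont_tilt_loss).
    apply Rle_trans with (/ INR K * psum (fun _ => exp (- (eta * eta) * l + 2 * e)) K).
    - apply Rmult_le_compat_l; [lra|]. apply psum_le. intros; apply E_tilt_loss; lia.
    - rewrite psum_const. right; field; lra. }
  assert (HZ : exp (- e) - exp (- (eta * eta / 2) * l + e) <= E mean_tilt).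
  { unfold mean_tilt. rewrite E_scal, E_psum by (try (intros ? _); try apply cont_psum; intros; apply cont_trunc_tilt).
    apply Rle_trans with (/ INR K * psum (fun _ => exp (- e) - exp (- (eta * eta / 2) * l + e)) K).
    - rewrite psum_const. right; field; lra.
    - apply Rmult_le_compat_l; [lra|]. apply psum_le. intros; apply E_trunc_tilt_ge; lia. }
  pose proof E_mean_tilt_sq as HZ2.
  destruct err_parts as (He0 & _ & _). pose proof l_ge.
  destruct (exp_small_bounds e) as (B1 & B2 & B3); [unfold e in *; lra|].
  rewrite exp_plus in HDD, HZ, HZ2. fold l in Hw.
  assert (Hw2 : exp (- (eta * eta) * l) <= d).
  { eapply Rle_trans; [|exact Hw]. apply exp_le. nra. }
  pose proof (exp_pos (- (eta * eta) * l)). pose proof (exp_pos (- (eta * eta / 2) * l)).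
  set (w1 := exp (- (eta * eta) * l)) in *. set (w2 := exp (- (eta * eta / 2) * l)) in *.
  pose proof (exp_pos e). pose proof (exp_pos (2 * e)). unfold e in *.
  assert (w1 * exp (2 * err K) <= 2 * d) by nra.
  assert (w1 * exp (err K) <= 2 * d) by nra.
  assert (w2 * exp (err K) <= 2 * d) by nra.
  lra.
Qed.

End Window.

(** * Choice of the window and end of the lower bound *)

(** The first part uses [ln K <= 2 sqrt K]. In the second, [T >= 9] gives [Hlen K >= 9^K], leaving
    [1024 K^4 / 3^K]; with [3^K >= (K/5)^5] this is at most [1024 * 3125 / K]. *)
Lemma err_le K : (3 <= K)%nat -> err K <= (64 * INR r + 3200000) / sqrt (INR K).
Proof.
  intros HK. pose proof (INR_ge_three K HK) as Hy. unfold err.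
  set (y := INR K) in *. set (t := sqrt y).
  assert (Ht : 0 < t) by (apply sqrt_lt_R0; lra).
  assert (Htt : t * t = y) by (apply sqrt_sqrt; lra).
  pose proof (ln_ge_one y Hy) as Hl1.
  assert (Hl2 : ln y <= 2 * t).
  { rewrite <- Htt, ln_mult by auto. pose proof (ln_le_sub1 t Ht). lra. }
  assert (Ht1 : 1 <= t) by nra.
  pose proof (ln_le_sub1 y ltac:(lra)) as Hl3.
  assert (H3 : 0 < 3 ^ K) by (apply pow_lt; lra).
  assert (HH : 3 ^ K * 3 ^ K <= Hlen K).
  { rewrite Hlen_eq. pose proof T_ge. rewrite <- Rpow_mult_distr.
    assert ((3 * 3) ^ K <= INR T ^ K) by (apply pow_incr; lra).
    pose proof (pow_lt (3 * 3) K ltac:(lra)). nra. }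
  assert (Hs : sqrt (ln y / Hlen K) <= y / 3 ^ K).
  { apply Rle_trans with (sqrt ((y / 3 ^ K) * (y / 3 ^ K))).
    - apply sqrt_le_1_alt. apply Rle_trans with (y * y / (3 ^ K * 3 ^ K)); [|right; field; lra].
      unfold Rdiv. apply Rmult_le_compat; [lra| |nra|].
      + left. apply Rinv_0_lt_compat, Hlen_pos.
      + apply Rinv_le_contravar; auto. nra.
    - right. apply sqrt_square. left. apply Rdiv_lt_0_compat; lra. }
  assert (H5 : (y / 5) ^ 5 <= 3 ^ K).
  { eapply Rle_trans; [|apply exp_nat]. fold y.
    replace (exp y) with (exp (y / 5) ^ 5).
    - apply pow_incr. pose proof (exp_ineq1_le (y / 5)). lra.
    - simpl. rewrite Rmult_1_r, <- !exp_plus. f_equal. field. }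
  assert (Hsy : y ^ 4 / 3 ^ K <= 3125 / y).
  { apply Rmult_le_reg_r with (3 ^ K); auto. unfold Rdiv at 1. rewrite Rmult_assoc, Rinv_l, Rmult_1_r by lra.
    apply Rle_trans with (3125 / y * (y / 5) ^ 5); [right; field; lra|].
    apply Rmult_le_compat_l; auto. left; apply Rdiv_lt_0_compat; lra. }
  assert (Hyt : / y <= / t) by (apply Rinv_le_contravar; nra).
  pose proof (pos_INR r) as Hr0.
  rewrite Rmult_plus_distr_r.
  replace ((64 * INR r + 3200000) / t) with (64 * INR r / t + 3200000 * / t) by (field; lra).
  apply Rplus_le_compat.
  - apply Rle_trans with (2 * INR r / y * (16 * (2 * t))).
    + apply Rmult_le_compat_l; [apply Rdiv_le_0_compat; lra|lra].
    + right. rewrite <- Htt. field. lra.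
  - apply Rle_trans with (16 * y ^ 2 * (4 * (y / 3 ^ K)) * (16 * y)).
    + pose proof (sqrt_pos (ln y / Hlen K)). pose proof (pow_le y 2 ltac:(lra)).
      apply Rmult_le_compat; [apply Rmult_le_pos; lra|lra| |lra].
      apply Rmult_le_compat_l; lra.
    + replace (16 * y ^ 2 * (4 * (y / 3 ^ K)) * (16 * y)) with (1024 * (y ^ 4 / 3 ^ K)) by (field; lra).
      unfold Rdiv in Hsy at 2. lra.
Qed.

Lemma window_exists d K0 : 0 < d -> exists K, (K0 <= K)%nat /\ (3 <= K)%nat /\ (2 * r <= K)%nat /\
  err K <= d /\ exp (- (eta * eta / 2) * ln (INR K)) <= d.
Proof.
  intros Hd. set (C := (64 * INR r + 3200000) / d). pose proof (pos_INR r) as Hr0.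
  assert (HC : 0 < C) by (apply Rdiv_lt_0_compat; lra).
  assert (Hee : 0 < eta * eta / 2) by nra.
  set (u := / d / (eta * eta / 2)).
  destruct (INR_unbounded (C * C + exp u)) as [K1 HK1].
  set (K := (K1 + K0 + 3 + 2 * r)%nat). exists K.
  assert (HK : C * C + exp u <= INR K).
  { assert (INR K1 <= INR K) by (apply le_INR; unfold K; lia). lra. }
  assert (HK3 : (3 <= K)%nat) by (unfold K; lia).
  pose proof (INR_ge_three K HK3). pose proof (exp_pos u).
  repeat split; try (unfold K; lia).
  - eapply Rle_trans; [apply err_le; auto|].
    assert (Hs : C <= sqrt (INR K)).
    { rewrite <- (sqrt_square C) by lra. apply sqrt_le_1_alt. lra. }
    apply Rmult_le_reg_r with (sqrt (INR K)); [lra|].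
    unfold Rdiv. rewrite Rmult_assoc, Rinv_l by lra.
    replace (64 * INR r + 3200000) with (C * d) by (unfold C; field; lra). nra.
  - assert (Hu : u <= ln (INR K)).
    { rewrite <- (ln_exp u). apply ln_le; [auto|nra]. }
    assert (Hv : / d <= eta * eta / 2 * ln (INR K)).
    { replace (/ d) with (eta * eta / 2 * u) by (unfold u; field; lra). apply Rmult_le_compat_l; lra. }
    replace (- (eta * eta / 2) * ln (INR K)) with (- (eta * eta / 2 * ln (INR K))) by ring.
    rewrite exp_Ropp. rewrite <- (Rinv_inv d). apply Rinv_le_contravar; [apply Rinv_0_lt_compat; lra|].
    pose proof (exp_ineq1_le (eta * eta / 2 * ln (INR K))). lra.
Qed.

Lemma bad_null K0 : lebesgue_null (fun x => 0 < x < 1 /\ forall K, (K0 <= K)%nat -> bad K x).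
Proof.
  apply null_of_E. intros e He.
  set (d := Rmin (/ 4) (e / 44)).
  assert (Hd : 0 < d <= / 4) by (split; [apply Rmin_pos; lra|apply Rmin_l]).
  assert (Hde : d <= e / 44) by apply Rmin_r.
  destruct (window_exists d K0 ltac:(lra)) as (K & HK0 & HK3 & HKr & Herr & Hw).
  assert (Ho : forall k, {o | (o < K)%nat /\
    (INR K - INR r) * (INR (T ^ S k) - INR (T ^ k)) <=
    INR K * psum (fun i => indic (T ^ k) (T ^ S k) i * keep K o (sigma i)) (T ^ S k)}).
  { intros k. apply constructive_indefinite_description.
    apply good_offset; try lia. apply Nat.pow_le_mono_r; lia. }
  exists (detector K (fun k => proj1_sig (Ho k))).
  pose proof (fun k => proj2_sig (Ho k)) as Ho'.
  repeat split.
  - apply cont_detector.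
  - intros x. apply detector_ge0; auto.
  - eapply Rle_trans; [apply (E_detector K HK3 HKr d Hd Herr Hw _ Ho')|]. lra.
  - intros x Hx. eapply detector_bad; eauto.
Qed.

Context (HT16 : 16 <= eta * eta * INR T).

(** Replacing [Hlen k * ln K] by [N * ln (ln N)] at [N = T^(k+1)] costs a factor [1 - eta]; the
    earlier sum costs [4 * (eta/4)], since [16 <= eta^2 T]. Finally
    [(1 - 2 eta)(1 - eta) - eta >= 1 - 4 eta]. *)
Lemma lower_step K k x : (3 <= K)%nat -> (K <= k < 2 * K)%nat ->
  ln (2 * ln (INR T)) <= eta * ln (INR K) ->
  (1 - 2 * eta) * sqrt (Hlen k * ln (INR K)) <= perm_sum' (T ^ S k) x - perm_sum' (T ^ k) x ->
  - 1 * perm_sum' (T ^ k) x <= (1 + 3 * 1) * sqrt (INR (T ^ k) * ln (ln (INR (T ^ k)))) ->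
  (1 - 4 * eta) * sqrt (INR (T ^ S k) * ln (ln (INR (T ^ S k)))) <= perm_sum' (T ^ S k) x.
Proof.
  intros HK Hk HTK Hblk Hprev.
  pose proof T_ge as HT9. pose proof (ln_ge_one (INR T) ltac:(lra)) as HlT.
  pose proof (INR_ge_three K HK) as HK3. pose proof (ln_ge_one _ HK3) as HlK.
  assert (HK' : INR K <= INR k) by (apply le_INR; lia).
  assert (HS : INR (S k) <= 2 * INR K).
  { replace (2 * INR K) with (INR (2 * K)) by (rewrite mult_INR; simpl; ring). apply le_INR. lia. }
  rewrite S_INR in HS.
  assert (Hpk : 0 < INR T ^ k) by (apply pow_lt; lra).
  assert (HlogN : ln (INR (T ^ S k)) = (INR k + 1) * ln (INR T)).
  { rewrite pow_INR, ln_pow, S_INR; lra. }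
  assert (HlogP : ln (INR (T ^ k)) = INR k * ln (INR T)) by (rewrite pow_INR, ln_pow; lra).
  assert (HN : INR (T ^ S k) = INR T * INR T ^ k) by (rewrite pow_INR; reflexivity).
  assert (HP : INR (T ^ k) = INR T ^ k) by apply pow_INR.
  rewrite HlogN, HN. rewrite HlogP, HP in Hprev.
  set (LN := ln ((INR k + 1) * ln (INR T))). set (LP := ln (INR k * ln (INR T))) in *.
  assert (HLP : 0 <= LP).
  { rewrite <- ln_1. apply ln_le; [lra|nra]. }
  assert (HLPN : LP <= LN) by (apply ln_le; nra).
  assert (HLN : LN <= (1 + eta) * ln (INR K)).
  { apply Rle_trans with (ln (INR K * (2 * ln (INR T)))).
    - apply ln_le; nra.
    - rewrite ln_mult by lra. lra. }
  set (B := INR T * INR T ^ k * LN).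
  assert (HB0 : 0 <= B) by (unfold B; apply Rmult_le_pos; nra).
  assert (H1 : (1 - eta) * sqrt B <= sqrt (Hlen k * ln (INR K))).
  { rewrite <- (sqrt_square (1 - eta)) by lra. rewrite <- sqrt_mult by nra.
    apply sqrt_le_1_alt. unfold B. rewrite Hlen_eq.
    assert (HT1 : (1 - eta) * INR T <= INR T - 1) by nra.
    assert (HL1 : (1 - eta) * LN <= ln (INR K)).
    { apply Rle_trans with ((1 - eta) * ((1 + eta) * ln (INR K))); [apply Rmult_le_compat_l; lra|nra]. }
    replace ((1 - eta) * (1 - eta) * (INR T * INR T ^ k * LN))
      with (((1 - eta) * INR T) * INR T ^ k * ((1 - eta) * LN)) by ring.
    apply Rmult_le_compat; [|nra|apply Rmult_le_compat_r; lra|exact HL1].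
    apply Rmult_le_pos; nra. }
  assert (H2 : sqrt (INR T ^ k * LP) <= eta / 4 * sqrt B).
  { rewrite <- (sqrt_square (eta / 4)) by lra. rewrite <- sqrt_mult by nra.
    apply sqrt_le_1_alt. unfold B.
    replace (eta / 4 * (eta / 4) * (INR T * INR T ^ k * LN))
      with ((eta * eta * INR T / 16) * (INR T ^ k * LN)) by field.
    assert (INR T ^ k * LP <= INR T ^ k * LN) by (apply Rmult_le_compat_l; lra).
    assert (0 <= INR T ^ k * LP) by (apply Rmult_le_pos; lra). nra. }
  pose proof (sqrt_pos B) as Hs.
  assert ((1 - 2 * eta) * ((1 - eta) * sqrt B) <= (1 - 2 * eta) * sqrt (Hlen k * ln (INR K)))
    by (apply Rmult_le_compat_l; lra).
  fold B. nra.
Qed.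

Lemma lower_half_T : lebesgue_null (fun x => 0 < x < 1 /\
  ~ forall N0, exists N, (N0 <= N)%nat /\
    (1 - 4 * eta) * sqrt (INR N * ln (ln (INR N))) <= perm_sum' N x).
Proof.
  (* Index 0 is the failure of a crude lower bound for the sums, with constant [1 + 3 * 1 = 4];
     index [S K0] says that every window from [K0] on is bad. *)
  set (A := fun j : nat => match j with
    | O => fun x => 0 < x < 1 /\ ~ exists N0, forall N, (N0 <= N)%nat ->
        - 1 * perm_sum' N x <= (1 + 3 * 1) * sqrt (INR N * ln (ln (INR N)))
    | S K0 => fun x => 0 < x < 1 /\ forall K, (K0 <= K)%nat -> bad K x
    end).
  apply lebesgue_null_mono with (fun x => exists j, A j x).
  2:{ apply lebesgue_null_union. intros [|K0].
      - apply (upper_half n q sigma 1 (- 1) Hgap Hsigma); lra.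
      - apply bad_null. }
  intros x [Hx Hn]. apply NNPP. intros HA. apply Hn. intros N0.
  assert (Hup : exists N1, forall N, (N1 <= N)%nat ->
    - 1 * perm_sum' N x <= (1 + 3 * 1) * sqrt (INR N * ln (ln (INR N)))).
  { apply NNPP. intros h. apply HA. exists 0%nat. split; auto. }
  destruct Hup as [N1 HN1].
  destruct (INR_unbounded (exp (ln (2 * ln (INR T)) / eta))) as [K1 HK1].
  set (K0 := (N0 + N1 + K1 + 3)%nat).
  assert (Hb : exists K, (K0 <= K)%nat /\ ~ bad K x).
  { apply NNPP. intros h. apply HA. exists (S K0). split; auto. intros K HK.
    apply NNPP. intros h'. apply h. eauto. }
  destruct Hb as (K & HK & Hnb). apply not_all_ex_not in Hnb. destruct Hnb as [k Hnb].
  apply imply_to_and in Hnb. destruct Hnb as [Hk Hblk]. apply Rnot_lt_le in Hblk.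
  pose proof (Nat.pow_gt_lin_r T k ltac:(lia)). pose proof (Nat.pow_gt_lin_r T (S k) ltac:(lia)).
  exists (T ^ S k)%nat. split; [unfold K0 in HK; lia|].
  apply (lower_step K k x); auto; [unfold K0 in HK; lia| |apply HN1; unfold K0 in HK; lia].
  assert (Hle : INR K1 <= INR K) by (apply le_INR; unfold K0 in HK; lia).
  assert (Hln : ln (2 * ln (INR T)) / eta <= ln (INR K)).
  { rewrite <- (ln_exp (ln (2 * ln (INR T)) / eta)). apply ln_le; [apply exp_pos|lra]. }
  apply (Rmult_le_compat_l eta) in Hln; [|lra].
  replace (eta * (ln (2 * ln (INR T)) / eta)) with (ln (2 * ln (INR T))) in Hln by (field; lra).
  exact Hln.
Qed.

End Lower.

Lemma lower_half n q sigma eta : hadamard_gap n q ->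
  (forall i j, sigma i = sigma j -> i = j) -> 0 < eta <= / 2 ->
  lebesgue_null (fun x => 0 < x < 1 /\ ~ forall N0, exists N, (N0 <= N)%nat /\
    (1 - 4 * eta) * sqrt (INR N * ln (ln (INR N))) <= perm_sum n sigma N x).
Proof.
  intros Hgap Hs He. destruct (gap_exponent n q Hgap) as [r Hr].
  destruct (INR_unbounded (16 / (eta * eta))) as [T0 HT0].
  apply (lower_half_T n q Hgap sigma Hs r Hr eta He (T0 + 9)); [lia|].
  rewrite plus_INR. pose proof (pos_INR 9).
  replace 16 with (eta * eta * (16 / (eta * eta))) by (field; lra).
  apply Rmult_le_compat_l; [nra|lra].
Qed.

(** * Combining the two halves *)

Lemma lil_ratio a N : (9 <= N)%nat ->
  let b := sqrt (INR N * ln (ln (INR N))) in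
  0 < b /\ a / sqrt (2 * INR N * ln (ln (INR N))) = a / b * (1 / sqrt 2).
Proof.
  intros HN. apply le_INR in HN. simpl in HN.
  assert (Hl : 1 < ln (INR N)).
  { apply exp_lt_inv. rewrite exp_ln by lra. pose proof exp_le_3. lra. }
  assert (Hll : 0 < ln (ln (INR N))) by (rewrite <- ln_1; apply ln_increasing; lra).
  assert (Hb : 0 < sqrt (INR N * ln (ln (INR N)))) by (apply sqrt_lt_R0; nra).
  assert (H2 : 0 < sqrt 2) by (apply sqrt_lt_R0; lra).
  split; auto. rewrite Rmult_assoc, sqrt_mult by nra. field. lra.
Qed.

Theorem theorem3 (n : nat -> nat) (q : R) (sigma : nat -> nat)
  (Hgap : hadamard_gap n q) (Hsigma : is_permutation sigma) :
  ae_in_01 (fun x =>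
    limsup_eq
      (fun N : nat =>
         psum (fun k => cos (2 * PI * INR (n (sigma k)) * x)) N
         / sqrt (2 * INR N * ln (ln (INR N))))
      (1 / sqrt 2)).
Proof.
  destruct Hsigma as [Hs _]. unfold ae_in_01.
  (* A sequence tending to 0 makes the exceptional set a countable union; the shift by 2 keeps
     [eta j <= 1/2], as the lower half demands. *)
  set (eta := fun j : nat => / (INR j + 2)).
  assert (Heta : forall j, 0 < eta j <= / 2).
  { intros j. pose proof (pos_INR j). split; [apply Rinv_0_lt_compat; lra|].
    apply Rinv_le_contravar; lra. }
  set (A := fun j x => 0 < x < 1 /\ ~ exists N0, forall N, (N0 <= N)%nat ->
     1 * perm_sum n sigma N x <= (1 + 3 * eta j) * sqrt (INR N * ln (ln (INR N)))).
  set (B := fun j x => 0 < x < 1 /\ ~ forall N0, exists N, (N0 <= N)%nat /\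
    (1 - 4 * eta j) * sqrt (INR N * ln (ln (INR N))) <= perm_sum n sigma N x).
  apply lebesgue_null_mono with
    (fun x => exists i : nat, match i with O => fun x => exists j, A j x | _ => fun x => exists j, B j x end x).
  2:{ apply lebesgue_null_union. intros [|_]; apply lebesgue_null_union; intros j; specialize (Heta j).
      - apply (upper_half n q sigma (eta j) 1); auto; lra.
      - apply (lower_half n q sigma (eta j)); auto. }
  intros x [Hx Hn]. apply NNPP. intros HAB. apply Hn. intros eps Heps.
  destruct (INR_unbounded (4 / eps)) as [j Hj].
  assert (Hje : 4 * eta j <= eps).
  { apply Rmult_le_reg_r with (INR j + 2); [pose proof (pos_INR j); lra|].
    unfold eta. rewrite Rmult_assoc, Rinv_l by (pose proof (pos_INR j); lra).
    replace 4 with (eps * (4 / eps)) by (field; lra). nra. }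
  assert (H2 : 0 < 1 / sqrt 2 <= 1).
  { assert (1 <= sqrt 2) by (rewrite <- sqrt_1; apply sqrt_le_1_alt; lra).
    split; [apply Rdiv_lt_0_compat; lra|].
    apply Rmult_le_reg_r with (sqrt 2); [lra|]. unfold Rdiv. rewrite Rmult_assoc, Rinv_l; lra. }
  specialize (Heta j).
  change (psum (fun k => cos (2 * PI * INR (n (sigma k)) * x))) with (fun N => perm_sum n sigma N x).
  split.
  - assert (HA : exists N0, forall N, (N0 <= N)%nat ->
      1 * perm_sum n sigma N x <= (1 + 3 * eta j) * sqrt (INR N * ln (ln (INR N)))).
    { apply NNPP. intros h. apply HAB. exists 0%nat, j. split; auto. }
    destruct HA as [N0 HN0]. exists (N0 + 9)%nat. intros N HN.
    destruct (lil_ratio (perm_sum n sigma N x) N ltac:(lia)) as [Hb Hr]. rewrite Hr.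
    specialize (HN0 N ltac:(lia)). set (b := sqrt (INR N * ln (ln (INR N)))) in *.
    assert (perm_sum n sigma N x / b <= 1 + 3 * eta j).
    { apply Rmult_le_reg_r with b; auto. unfold Rdiv. rewrite Rmult_assoc, Rinv_l; lra. }
    nra.
  - intros N0.
    assert (HB : forall N0, exists N, (N0 <= N)%nat /\
      (1 - 4 * eta j) * sqrt (INR N * ln (ln (INR N))) <= perm_sum n sigma N x).
    { apply NNPP. intros h. apply HAB. exists 1%nat, j. split; auto. }
    destruct (HB (N0 + 9)%nat) as (N & HN & HN1). exists N. split; [lia|].
    destruct (lil_ratio (perm_sum n sigma N x) N ltac:(lia)) as [Hb Hr]. rewrite Hr.
    set (b := sqrt (INR N * ln (ln (INR N)))) in *.
    assert (1 - 4 * eta j <= perm_sum n sigma N x / b).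
    { apply Rmult_le_reg_r with b; auto. unfold Rdiv. rewrite Rmult_assoc, Rinv_l; lra. }
    nra.
Qed.
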